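(* Let $G$ be a finite undirected graph and $u\in V(G)$ such that all vertices in $N(u)$ are pairwise adjacent. Then \[\mathrm{Ind}(G)\simeq\bigvee_{v\in N(u)}\mathrm{susp}\,\mathrm{Ind}(G\setminus(N(u)\cup N(v))).\] Moreover, suppose that for each $v\in N(u)$ with $G\setminus(N(u)\cup N(v))\neq\emptyset$, $\mathcal{G}_v$ is a set of generating faces of $\mathrm{Ind}(G\setminus(N(u)\cup N(v)))$. Then the union of \[\bigcup_{v\in N(u),\ G\setminus(N(u)\cup N(v))=\emptyset}\{\{v\}\}\quad\text{and}\quad\bigcup_{v\in N(u),\ G\setminus(N(u)\cup N(v))\neq\emptyset}\{\{v\}\cup\sigma\mid\sigma\in\mathcal{G}_v\}\] is a set of generating faces of $\mathrm{Ind}(G)$.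
   Context: $N(v)$ is the set of vertices adjacent to $v$. $\mathrm{Ind}(H)$ is the simplicial complex with vertex set $V(H)$ whose simplices are the independent sets of $H$; $H\setminus W$ is the induced subgraph on $V(H)\setminus W$; for the empty graph, $\mathrm{Ind}$ is the empty complex. Conventions: $\mathrm{susp}(\emptyset)=S^0$ and a wedge over an empty index set is a point. A set $\mathcal{G}$ of maximal faces of a simplicial complex $\Delta$ is a set of generating faces if the complex $\Delta\setminus\mathcal{G}$ obtained by removing the faces in $\mathcal{G}$ (i.e. removing their interiors) is contractible. *)

(* Defs.v *)
From HB Require Import structures.
From mathcomp Require Import all_boot all_order all_algebra.
From mathcomp Require Import all_classical all_reals all_analysis.

Set Implicit Arguments.
Unset Strict Implicit.
Unset Printing Implicit Defensive.

Import Order.TTheory GRing.Theory Num.Theory.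
Import numFieldNormedType.Exports.
Local Open Scope ring_scope.

(* Graphs.  A finite undirected (simple) graph is a symmetric,         *)
(* irreflexive relation [e] on a finite vertex type [T].  Induced      *)
(* subgraphs are represented by their vertex set [W : {set T}].        *)

Definition simple_graph (T : finType) (e : rel T) : Prop :=
  symmetric e /\ irreflexive e.

Definition nbhd (T : finType) (e : rel T) (v : T) : {set T} := [set w | e v w].

Definition independent_in (T : finType) (e : rel T) (W : {set T})
    (s : {set T}) : bool :=
  (s \subset W) && [forall x in s, forall y in s, ~~ e x y].

(* Ind(G[W]) : the simplicial complex, given by its set of faces
   (for W empty it is the empty complex, whose only face is the empty
   face; its geometric realization is the empty space). *)
Definition Ind (T : finType) (e : rel T) (W : {set T}) : {set {set T}} :=
  [set s | independent_in e W s].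

Definition gminus (T : finType) (X : {set T}) : {set T} := ~: X.

(* simplicial (unreduced) suspension: two new cone points [inr true]
   (north) and [inr false] (south).  susp {emptyset} = S^0. *)
Definition susp (V : finType) (K : {set {set V}}) : {set {set (V + bool)}} :=
  [set t | [exists s in K,
     [|| t == inl @: s, t == inr true |: (inl @: s)
       | t == inr false |: (inl @: s)]]].

(* wedge of the complexes [K i], i in [J], glued at the base vertices
   [b i] (all identified to the single vertex [None]); a wedge over an
   empty index set is a point (the face [set None]). *)
Definition wedge_inj (I V : finType) (b : I -> V) (i : I) (w : V)
    : option (I * V) :=
  if w == b i then None else Some (i, w).

Definition wedge_cx (I V : finType) (J : {set I}) (K : I -> {set {set V}})
    (b : I -> V) : {set {set option (I * V)}} :=
  [set finset.set0; [set None]] :|: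
  [set t | [exists i in J, exists s in K i, t == wedge_inj b i @: s]].

Definition maximal_face (V : finType) (K : {set {set V}}) (s : {set V}) :=
  (s \in K) && [forall t in K, (s \subset t) ==> (t == s)].

(* Geometric realization.  For a family of faces F, |F| is the set of  *)
(* points of the standard simplex in R^V whose support is a face in F; *)
(* it carries the subspace topology of R^V.  For a simplicial complex  *)
(* K this is the usual geometric realization; for K minus a set G of   *)
(* faces (F = K :\: G) it is |K| with the open cells of G removed.     *)

Definition support (R : realType) (V : finType) (x : V -> R) : {set V} :=
  [set v | x v != 0].

Definition realization_set (R : realType) {V : finType} (F : {set {set V}})
    : set {ptws V -> R} := (
  [set x | (forall v, 0 <= x v) /\ (\sum_v x v = 1) /\ (support x \in F)])%classic.

Definition realization (R : realType) {V : finType} (F : {set {set V}})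
    : topologicalType := set_type (@realization_set R V F).

Definition unit_interval (R : realType) : topologicalType :=
  set_type (`[0%R, 1%R]%classic : set R).

Definition homotopic (R : realType) {X Y : topologicalType} (f g : X -> Y)
    : Prop :=
  exists H : (X * unit_interval R)%type -> Y,
    continuous H /\
    (forall x (t : unit_interval R), set_val t = 0 -> H (x, t) = f x) /\
    (forall x (t : unit_interval R), set_val t = 1 -> H (x, t) = g x).

Definition homotopy_equivalent (R : realType) (X Y : topologicalType)
    : Prop :=
  exists (f : X -> Y) (g : Y -> X),
    continuous f /\ continuous g /\
    @homotopic R X X (g \o f) idfun /\ @homotopic R Y Y (f \o g) idfun.

Definition contractible (R : realType) (X : topologicalType) : Prop :=
  exists x0 : X, @homotopic R X X (@idfun X) (cst x0).

Definition generating_faces (R : realType) {V : finType}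
    (K G : {set {set V}}) : Prop :=
  (forall s, s \in G -> maximal_face K s) /\
  contractible R (@realization R V (K :\: G)).
Arguments realization_set R {V} F.
Arguments realization R {V} F.
Arguments generating_faces R {V} K G.
Arguments homotopic R {X Y} f g.
Arguments homotopy_equivalent R X Y.
Arguments contractible R X.

(* Main.v *)
(** Write N for the clique N(u) and L v for Ind(G \ (N(u) u N(v))).  A face of
    Ind(G) meets N in at most one vertex, so Ind(G) is the cone with apex u over
    Ind(G \ N(u) \ u), to which a cone with top v is attached along L v for every
    v in N; the wedge of suspensions has the same shape, with apex the base point
    and the south poles as tops.  In both complexes, with c the total weight of
    the tops, the identity is homotopic to an explicit "collapse": the part
    c = 0 goes to the apex, the part 0 <= c <= 1/2 is spread over the cone from
    the apex to L v and the part 1/2 <= c <= 1 over the cone from L v to v.  The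
    maps x |-> to_wedge x and the simplicial map of the wedge that forgets the
    branch compose to the two collapses, which gives the homotopy equivalence.
    On the complex without the generating faces, a collapsed point with top v
    only depends on c, v and a point of the contractible complex L v minus its
    generating faces; contracting the latter and then letting c tend to 0
    contracts everything to u. *)

Require Import Defs.
From HB Require Import structures.
From mathcomp Require Import all_boot all_order all_algebra.
From mathcomp Require Import all_classical all_reals all_analysis.
From mathcomp Require Import ring lra.

Set Implicit Arguments.
Unset Strict Implicit.
Unset Printing Implicit Defensive.

Import Order.TTheory GRing.Theory Num.Theory.
Import numFieldNormedType.Exports.
Local Open Scope ring_scope.

(** * Points of a realization in barycentric coordinates *)

Section Barycentric.
Context {R : realType} {V : finType} {F : {set {set V}}}.

Definition bary (x : realization R F) (v : V) : R := set_val x v.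

Definition point_of (a : V -> R) (aF : realization_set R F a) :
  realization R F := exist _ a (mem_set aF).

Lemma bary_point_of (a : V -> R) (aF : realization_set R F a) :
  bary (point_of aF) = a.
Proof. by []. Qed.

Lemma bary_inj (x y : realization R F) : bary x =1 bary y -> x = y.
Proof. by move=> xy; apply: val_inj; apply/funext => v; exact: xy. Qed.

Lemma baryP (x : realization R F) : realization_set R F (bary x).
Proof. exact: (set_valP x). Qed.

Lemma bary_ge0 (x : realization R F) v : 0 <= bary x v.
Proof. by have [] := baryP x. Qed.

Lemma bary_sum (x : realization R F) : \sum_v bary x v = 1.
Proof. by have [_ []] := baryP x. Qed.

Lemma bary_support (x : realization R F) : Defs.support (bary x) \in F.
Proof. by have [_ []] := baryP x. Qed.

Lemma bary_le1 (x : realization R F) v : bary x v <= 1.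
Proof.
rewrite -(bary_sum x) (bigD1 v) //= lerDl.
by apply: sumr_ge0 => w _; exact: bary_ge0.
Qed.

Lemma continuous_bary v : continuous (fun x : realization R F => bary x v).
Proof.
move=> x; apply: (@continuous_comp (realization R F) {ptws V -> R} R set_val
  (fun a => a v)).
  exact: initial_continuous.
exact: (@proj_continuous V (fun=> R) v (set_val x)).
Qed.

(** The realization is a subspace of a product, so continuity is tested on coordinates: first into
    the product, a supremum of initial topologies, then into the subspace. The form at a single
    point serves maps whose formula is controlled only near that point. *)
Lemma continuous_at_realization {X : topologicalType} (f : X -> realization R F) p :
  (forall v, {for p, continuous (fun q => bary (f q) v)}) ->
  {for p, continuous f}.
Proof.
move=> fc; have cv : {for p, continuous (set_val \o f : X -> {ptws V -> R})}.
  apply/cvg_sup => v A [_ [[B oB <-] /= Bfp] BA].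
  have : nbhs (bary (f p) v) B by exact: open_nbhs_nbhs.
  move=> /(fc v) h; apply: (@filterS _ (nbhs p) _ _ _ _ h) => q; exact: BA.
move=> A [_ [[B oB <-] /= Bfp] BA].
have : nbhs (set_val (f p)) B by exact: open_nbhs_nbhs.
move=> /cv h; apply: (@filterS _ (nbhs p) _ _ _ _ h) => q; exact: BA.
Qed.

Lemma continuous_realization {X : topologicalType} (f : X -> realization R F) :
  (forall v, continuous (fun q => bary (f q) v)) -> continuous f.
Proof. by move=> fc p; apply: continuous_at_realization => v; exact: fc. Qed.

End Barycentric.

(** * Continuity of real-valued formulas *)

Section RealContinuity.
Context {R : realType} {X : topologicalType}.
Implicit Types (f g : X -> R) (p : X).

Lemma continuous_add f g p : {for p, continuous f} -> {for p, continuous g} ->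
  {for p, continuous (fun x => f x + g x)}.
Proof. exact: continuousD. Qed.

Lemma continuous_sub f g p : {for p, continuous f} -> {for p, continuous g} ->
  {for p, continuous (fun x => f x - g x)}.
Proof. exact: continuousB. Qed.

Lemma continuous_mul f g p : {for p, continuous f} -> {for p, continuous g} ->
  {for p, continuous (fun x => f x * g x)}.
Proof. exact: continuousM. Qed.

Lemma continuous_inv f p : f p != 0 -> {for p, continuous f} ->
  {for p, continuous (fun x => (f x)^-1)}.
Proof. by move=> fp0 fc; apply: continuousV. Qed.

Lemma continuous_maxr f g p : {for p, continuous f} -> {for p, continuous g} ->
  {for p, continuous (fun x => Num.max (f x) (g x))}.
Proof. exact: continuous_max. Qed.

Lemma continuous_minr f g p : {for p, continuous f} -> {for p, continuous g} ->
  {for p, continuous (fun x => Num.min (f x) (g x))}.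
Proof. exact: continuous_min. Qed.

Lemma continuous_const (r : R) p : {for p, continuous (fun _ : X => r)}.
Proof. exact: cvg_cst. Qed.

Lemma continuous_for f : (forall p, {for p, continuous f}) -> continuous f.
Proof. by []. Qed.

Lemma continuous_bigsum (I : Type) (s : seq I) (P : pred I) (f : I -> X -> R) p :
  (forall i, P i -> {for p, continuous (f i)}) ->
  {for p, continuous (fun x => \sum_(i <- s | P i) f i x)}.
Proof.
move=> fc; elim: s => [|i s IH].
  under [X in {for _, continuous X}]eq_fun do rewrite big_nil.
  exact: continuous_const.
under [X in {for _, continuous X}]eq_fun do rewrite big_cons.
by case: ifP => // Pi; apply: continuous_add => //; exact: fc.
Qed.

End RealContinuity.

(** * Homotopies of maps into a realization *)

Section Homotopy.
Context {R : realType}.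

Definition time (t : unit_interval R) : R := set_val t.

Lemma timeP (t : unit_interval R) : 0 <= time t <= 1.
Proof. by have /= := set_valP t; rewrite in_itv. Qed.

Definition time_of (r : R) (r01 : 0 <= r <= 1) : unit_interval R :=
  exist _ r (mem_set (r01 : `[0, 1]%classic r)).

Lemma time_inj : injective time.
Proof. exact: val_inj. Qed.

Lemma continuous_time : continuous time.
Proof. exact: initial_continuous. Qed.

Lemma continuous_into_time {X : topologicalType} (f : X -> unit_interval R) :
  continuous (time \o f) -> continuous f.
Proof. exact: continuous_comp_initial. Qed.

Lemma continuous_fst {X Y : topologicalType} : continuous (@fst X Y).
Proof. by move=> x; exact: cvg_fst. Qed.

Lemma continuous_snd {X Y : topologicalType} : continuous (@snd X Y).
Proof. by move=> x; exact: cvg_snd. Qed.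

Lemma continuous_pair {X Y Z : topologicalType} (f : X -> Y) (g : X -> Z) :
  continuous f -> continuous g -> continuous (fun x => (f x, g x)).
Proof. by move=> fc gc x; apply: cvg_pair; [exact: fc | exact: gc]. Qed.

Lemma continuous_compose {X Y Z : topologicalType} (f : X -> Y) (g : Y -> Z) :
  continuous f -> continuous g -> continuous (fun x => g (f x)).
Proof. by move=> fc gc x; apply: continuous_comp; [exact: fc | exact: gc]. Qed.

Lemma continuous_reparam {X Y Y' Z : topologicalType} (L : X * Y -> Z)
    (k : Y' -> Y) :
  continuous L -> continuous k -> continuous (fun q : X * Y' => L (q.1, k q.2)).
Proof.
move=> Lc kc; have kc' := continuous_compose (@continuous_snd X Y') kc.
exact: (continuous_compose (continuous_pair continuous_fst kc') Lc).
Qed.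

Lemma homotopic_sym {X Y : topologicalType} (f g : X -> Y) :
  homotopic R f g -> homotopic R g f.
Proof.
move=> [H [Hc [H0 H1]]].
have r01 t : 0 <= 1 - time t <= 1 by have := timeP t; lra.
pose r t := time_of (r01 t).
have rc : continuous r.
  apply/continuous_into_time/continuous_for => t; apply: continuous_sub.
    exact: continuous_const.
  exact: continuous_time.
exists (fun q => H (q.1, r q.2)); split.
  exact: continuous_reparam.
have rE t : set_val (r t) = 1 - set_val t by [].
by split=> x t t01; [apply: H1 | apply: H0]; rewrite rE t01 ?subr0 ?subrr.
Qed.

Lemma continuous_bary_comp {X : topologicalType} {V : finType}
    {F : {set {set V}}} (f : X -> realization R F) v :
  continuous f -> continuous (fun x => bary (f x) v).
Proof. by move=> fc; exact: (continuous_compose fc (@continuous_bary _ _ _ v)). Qed.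

(* Gluing at time 1/2 is replaced by a single formula in barycentric
   coordinates: [H1 + H2 - g], where the first homotopy is stopped at time 1
   and the second one waits at time 0. *)
Lemma homotopic_trans {X : topologicalType} {V : finType} {F : {set {set V}}}
    (g f h : X -> realization R F) :
  homotopic R f g -> homotopic R g h -> homotopic R f h.
Proof.
move=> [H [Hc [H0 H1]]] [K [Kc [K0 K1]]].
have rP t : 0 <= Num.min (2 * time t) 1 <= 1.
  have := timeP t; case: (leP (2 * time t) 1); lra.
have sP t : 0 <= Num.max (2 * time t - 1) 0 <= 1.
  have := timeP t; case: (leP (2 * time t - 1) 0); lra.
pose r t := time_of (rP t); pose s t := time_of (sP t).
have tc : continuous (fun t : unit_interval R => 2 * time t).
  apply: continuous_for => t; apply: continuous_mul; first exact: continuous_const.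
  exact: continuous_time.
have rc : continuous r.
  apply/continuous_into_time/continuous_for => t; apply: continuous_minr; first exact: tc.
  exact: continuous_const.
have sc : continuous s.
  apply/continuous_into_time/continuous_for => t; apply: continuous_maxr.
    by apply: continuous_sub; [exact: tc | exact: continuous_const].
  exact: continuous_const.
pose L q := if 2 * time q.2 <= 1 then H (q.1, r q.2) else K (q.1, s q.2).
have rE t : time (r t) = Num.min (2 * time t) 1 by [].
have sE t : time (s t) = Num.max (2 * time t - 1) 0 by [].
exists L; split; last first.
  split=> x t; rewrite /L -/(time t) /= => t01; rewrite t01.
    by rewrite mulr0 ler01 H0// -/(time _) rE t01 mulr0 min_l.
  rewrite mulr1 ifF; last by lra.
  by rewrite K1// -/(time _) sE t01 max_l; lra.
have z01 : 0 <= (0 : R) <= 1 by lra.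
apply: continuous_realization => v.
have -> : (fun q => bary (L q) v) = (fun q => bary (H (q.1, r q.2)) v +
    bary (K (q.1, s q.2)) v - bary (K (q.1, time_of z01)) v).
  apply/funext => -[x t]; rewrite /L /=; have t01 := timeP t.
  case: ifP => t2.
    suff -> : s t = time_of z01 by rewrite addrK.
    by apply: time_inj; rewrite sE max_r // ; lra.
  rewrite H1; last by rewrite -/(time _) rE min_r //; lra.
  have -> : K (x, time_of z01) = g x by exact: K0.
  by rewrite addrAC subrr add0r.
apply: continuous_for => p; apply: continuous_sub; first apply: continuous_add.
- by apply: continuous_bary_comp; exact: continuous_reparam.
- by apply: continuous_bary_comp; exact: continuous_reparam.
- have zc : continuous (fun _ : unit_interval R => time_of z01).
    exact: cst_continuous.
  exact: continuous_bary_comp (continuous_reparam Kc zc) _.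
Qed.

(** The straight-line homotopy: coordinates are nonnegative, so strictly between the ends nothing
    cancels and the support is the union of the two supports. *)
Lemma homotopic_line {X : topologicalType} {V : finType} {F : {set {set V}}}
    (f g : X -> realization R F) :
  continuous f -> continuous g ->
  (forall x, Defs.support (bary (f x)) :|: Defs.support (bary (g x)) \in F) ->
  homotopic R f g.
Proof.
move=> fc gc fgF.
pose l (x : X) (t : unit_interval R) v :=
  (1 - time t) * bary (f x) v + time t * bary (g x) v.
have lF x t : realization_set R F (l x t).
  have /andP[t0 t1] := timeP t.
  have ge0 v : 0 <= (1 - time t) * bary (f x) v /\ 0 <= time t * bary (g x) v.
    by split; apply: mulr_ge0; rewrite ?bary_ge0 ?subr_ge0.
  split=> [v|]; first by have [? ?] := ge0 v; exact: addr_ge0.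
  split; first by rewrite big_split /= -!mulr_sumr !bary_sum; lra.
  (* [F] is not assumed closed under subsets, so the two ends, where the support is that of a single
     map, are treated apart. *)
  have [t00|tn0] := eqVneq (time t) 0.
    rewrite (_ : Defs.support _ = Defs.support (bary (f x))) ?bary_support//.
    by apply/setP => v; rewrite !inE /l t00 mul0r subr0 mul1r addr0.
  have [t11|tn1] := eqVneq (time t) 1.
    rewrite (_ : Defs.support _ = Defs.support (bary (g x))) ?bary_support//.
    by apply/setP => v; rewrite !inE /l t11 subrr mul1r mul0r add0r.
  suff -> : Defs.support (l x t) =
      Defs.support (bary (f x)) :|: Defs.support (bary (g x)) by exact: fgF.
  apply/setP => v; rewrite !inE /l; have [? ?] := ge0 v.
  rewrite paddr_eq0 // negb_and !mulf_eq0 subr_eq0 eq_sym (negbTE tn1).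
  by rewrite (negbTE tn0).
exists (fun q => point_of (lF q.1 q.2)); split; last first.
  split=> x t; rewrite -/(time t) => t01; apply: bary_inj => v.
    by rewrite bary_point_of /l t01 mul0r subr0 mul1r addr0.
  by rewrite bary_point_of /l t01 subrr mul1r mul0r add0r.
apply: continuous_realization => v; apply: continuous_for => p; rewrite /l.
have tc : {for p, continuous (fun q : X * unit_interval R => time q.2)}.
  exact: (continuous_compose continuous_snd continuous_time).
have bc (k : X -> realization R F) : continuous k ->
    {for p, continuous (fun q : X * unit_interval R => bary (k q.1) v)}.
  move=> kc; apply: continuous_bary_comp.
  exact: (continuous_compose continuous_fst kc).
apply: continuous_add; apply: continuous_mul => //; try exact: bc.
by apply: continuous_sub => //; exact: continuous_const.
Qed.

End Homotopy.

(** * Simplicial maps in barycentric coordinates *)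

Section Pushforward.
Context {R : realType} {V W : finType} (h : V -> W).

Definition push (y : V -> R) (w : W) : R := \sum_(p | h p == w) y p.

Lemma push_sum (y : V -> R) : \sum_w push y w = \sum_p y p.
Proof. by rewrite (partition_big h predT) //=. Qed.

(** Nonnegative weights cannot cancel within a fibre of [h], so the support of the pushed point is
    exactly the image of the support. *)
Lemma push_realization (F : {set {set V}}) (F' : {set {set W}}) (y : V -> R) :
  {in F, forall s : {set V}, h @: s \in F'} ->
  realization_set R F y -> realization_set R F' (push y).
Proof.
move=> FF' [y0 [y1 yF]]; split=> [w|]; first by apply: sumr_ge0.
split; first by rewrite push_sum.
suff -> : Defs.support (push y) = h @: Defs.support y by exact: FF'.
apply/setP => w; rewrite inE; apply/idP/imsetP => [|[p yp ->]].
  rewrite psumr_neq0 // => /hasP[p _ /andP[/eqP pw py]].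
  by exists p; rewrite ?inE ?gt_eqF.
rewrite inE in yp; rewrite psumr_neq0 //; apply/hasP; exists p.
  exact: mem_index_enum.
by rewrite eqxx lt_def yp y0.
Qed.

Lemma continuous_push {X : topologicalType} (f : X -> V -> R) q w :
  (forall v, {for q, continuous (fun r => f r v)}) ->
  {for q, continuous (fun r => push (f r) w)}.
Proof. by move=> fc; apply: continuous_bigsum => p _; exact: fc. Qed.

End Pushforward.

(** [g] may be discontinuous: at a zero of [f] a squeeze only needs [g] bounded. This handles the
    points where a link component is undefined but carries coefficient 0. *)
Lemma continuous_mul_bounded {R : realType} {X : topologicalType}
    (f g : X -> R) p :
  {for p, continuous f} -> f p = 0 -> (forall x, `|g x| <= 1) ->
  {for p, continuous (fun x => f x * g x)}.
Proof.
move=> fc fp0 g1; have f0 : (f x @[x --> p] --> (0 : R))%classic.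
  by rewrite -fp0; exact: fc.
suff : (f x * g x @[x --> p] --> (0 : R))%classic.
  by move=> h; rewrite /prop_for /continuous_at fp0 mul0r.
apply/norm_cvg0P; apply: (squeeze_cvgr (f := fun=> 0) (h := fun x => `|f x|)).
- by near=> x; rewrite normr_ge0 normrM ler_piMr ?normr_ge0.
- exact: cvg_cst.
- by apply/norm_cvg0P.
Unshelve. all: by end_near.
Qed.

Lemma continuous_near_eq {R : realType} {X : topologicalType} (f g : X -> R) p :
  (\forall x \near p, f x = g x) -> {for p, continuous f} ->
  {for p, continuous g}.
Proof.
move=> fg fc; have gp : f p = g p by exact: nbhs_singleton fg.
rewrite /prop_for /continuous_at -gp; apply: cvg_trans fc.
exact: near_eq_cvg.
Qed.

(* The contraction of [|F|], read in coordinates and extended arbitrarily to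
   all of [R^V], so that families of contractions are not dependent on the
   complex. *)
Lemma contractible_bary {R : realType} {V : finType} {F : {set {set V}}}
    (Z : topologicalType) :
  contractible R (realization R F) ->
  exists hq : ((V -> R) -> unit_interval R -> V -> R) * (V -> R),
  [/\ forall x t, realization_set R F (hq.1 x t),
      forall x t, realization_set R F x -> time t = 0 -> hq.1 x t = x,
      forall x t, time t = 1 -> hq.1 x t = hq.2 &
      forall (z : Z -> V -> R) (tau : Z -> unit_interval R) p,
        (forall v, {for p, continuous (fun r => z r v)}) ->
        (\forall r \near p, realization_set R F (z r)) ->
        {for p, continuous tau} ->
        forall v, {for p, continuous (fun r => hq.1 (z r) (tau r) v)} ].
Proof.
move=> [x0 [H [Hc [H0 H1]]]].
pose pt (x : V -> R) : realization R F :=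
  if pselect (realization_set R F x) is left xF then point_of xF else x0.
have ptE x : realization_set R F x -> bary (pt x) = x.
  by rewrite /pt; case: pselect.
exists (fun x t => bary (H (pt x, t)), bary x0); split=> /=.
- by move=> x t; exact: baryP.
- by move=> x t xF t0; rewrite H0 //= ptE.
- by move=> x t t1; rewrite H1.
move=> z tau p zc zF tauc v.
have ptc : {for p, continuous (fun r => pt (z r))}.
  apply: continuous_at_realization => w; apply: continuous_near_eq (zc w).
  by apply: filterS zF => r zrF; rewrite ptE.
have pc : {for p, continuous (fun r => (pt (z r), tau r))}.
  exact: cvg_pair ptc tauc.
apply: (@continuous_comp Z (realization R F * unit_interval R)%type R
  (fun r => (pt (z r), tau r)) (fun q => bary (H q) v)) => //.
exact: continuous_bary_comp.
Qed.

(** * Weight profiles of the collapse *)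

Section Weights.
Context {R : realType}.
Implicit Types c : R.

(* Profiles of the collapse, functions of the total top weight [c]: the weight
   of the apex, the factor of the tops, [c * link_weight c] as factor of the other
   vertices.  The total weight is 1 by [collapse_weights]. *)
Definition apex_weight c : R := Num.max (1 - 2 * c) 0 ^+ 2.
Definition top_weight c : R := Num.max (2 * c - 1) 0.
Definition link_weight c : R := 2 + (Num.max c 2^-1)^-1.
Definition stretch_weight c : R := (1 - Num.min c 2^-1)^-1 + top_weight c.

Lemma apex_weight0 : apex_weight 0 = 1.
Proof. by rewrite /apex_weight mulr0 subr0 max_l ?expr1n ?ler01. Qed.

Lemma apex_weight_ge0 c : 0 <= apex_weight c.
Proof. exact: sqr_ge0. Qed.

Lemma apex_weight_eq0 c : (apex_weight c == 0) = (2^-1 <= c).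
Proof.
rewrite /apex_weight sqrf_eq0; case: (leP (1 - 2 * c) 0) => h.
  by rewrite eqxx; apply/esym; lra.
by rewrite gt_eqF //; apply/esym/negbTE; rewrite -ltNge; lra.
Qed.

Lemma top_weight_ge0 c : 0 <= top_weight c.
Proof. by rewrite /top_weight le_max lexx orbT. Qed.

Lemma top_weight_eq0 c : (top_weight c == 0) = (c <= 2^-1).
Proof.
rewrite /top_weight; case: (leP (2 * c - 1) 0) => h.
  by rewrite eqxx; apply/esym; lra.
by rewrite gt_eqF //; apply/esym/negbTE; rewrite -ltNge; lra.
Qed.

Lemma link_weight_gt0 c : 0 < link_weight c.
Proof.
have : 0 < (Num.max c 2^-1)^-1 by rewrite invr_gt0 lt_max invr_gt0 ltr0n orbT.
by rewrite /link_weight; lra.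
Qed.

Lemma stretch_weight_gt0 c : 0 < stretch_weight c.
Proof.
have h : 0 < 1 - Num.min c 2^-1 by case: (leP c 2^-1); lra.
by rewrite /stretch_weight ltr_wpDr ?top_weight_ge0 // invr_gt0.
Qed.

(** The tops have total weight [c] and the other vertices [1 - c]. For [c <= 1/2] the identity reads
    [(1 - 2c)^2 + 4c(1 - c) = 1], and for [c >= 1/2] it reads [(2c - 1)c + (2c + 1)(1 - c) = 1].
    Squaring the apex weight is what makes the last factor divisible by [c] in the first range. *)
Lemma collapse_weights c : 0 <= c <= 1 ->
  apex_weight c + top_weight c * c + c * link_weight c * (1 - c) = 1.
Proof.
move=> c01; rewrite /apex_weight /top_weight /link_weight.
have [ch|ch] := leP c 2^-1.
  by rewrite max_l ?max_r ?invrK //; [ring | lra | lra].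
rewrite max_r ?max_l; try lra.
by field; apply/eqP; lra.
Qed.

(** Up to [c = 1/2] the tops are deleted and the rest is renormalised by [1 / (1 - c)]. Beyond it
    the factor is [2c + 1 = c * link_weight c], the one used by the collapse. *)
Lemma stretch_weights c : 0 <= c <= 1 ->
  top_weight c * c + stretch_weight c * (1 - c) = 1.
Proof.
move=> c01; rewrite /stretch_weight /top_weight.
have [ch|ch] := leP c 2^-1.
  by rewrite max_r; [field; apply/eqP; lra | lra].
have -> : 1 - 2^-1 = 2^-1 :> R by lra.
by rewrite max_l ?invrK; [ring | lra].
Qed.

Context {X : topologicalType}.
Implicit Types (f : X -> R) (p : X).

Lemma continuous_top_weight f p : {for p, continuous f} ->
  {for p, continuous (fun x => top_weight (f x))}.
Proof.
move=> fc; apply: continuous_maxr; last exact: continuous_const.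
apply: continuous_sub; last exact: continuous_const.
by apply: continuous_mul => //; exact: continuous_const.
Qed.

Lemma continuous_apex_weight f p : {for p, continuous f} ->
  {for p, continuous (fun x => apex_weight (f x))}.
Proof.
move=> fc; apply: (@continuous_mul _ _ (fun x => Num.max (1 - 2 * f x) 0)
  (fun x => Num.max (1 - 2 * f x) 0));
(apply: continuous_maxr; last exact: continuous_const);
(apply: continuous_sub; first exact: continuous_const);
by apply: continuous_mul => //; exact: continuous_const.
Qed.

Lemma continuous_link_weight f p : {for p, continuous f} ->
  {for p, continuous (fun x => link_weight (f x))}.
Proof.
move=> fc; apply: continuous_add; first exact: continuous_const.
apply: continuous_inv; last first.
  by apply: continuous_maxr => //; exact: continuous_const.
by rewrite gt_eqF // lt_max invr_gt0 ltr0n orbT.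
Qed.

Lemma continuous_stretch_weight f p : {for p, continuous f} ->
  {for p, continuous (fun x => stretch_weight (f x))}.
Proof.
move=> fc; apply: continuous_add; last exact: continuous_top_weight.
apply: continuous_inv; last first.
  apply: continuous_sub; first exact: continuous_const.
  by apply: continuous_minr => //; exact: continuous_const.
by rewrite gt_eqF //; case: (leP (f p) 2^-1); lra.
Qed.

End Weights.

(** * The collapse is homotopic to the identity *)

Section Collapse.
Context {R : realType} {V : finType} {F : {set {set V}}} (a : V) (N : {set V}).
Context (aN : a \notin N).
(** These closure conditions hold for the independence complex, for the wedge and for the complex
    without its generating faces, so one homotopy serves all three. *)
Context (FD : forall s, s \in F -> s :\: N \in F).
Context (Fa : forall s, s \in F -> a |: (s :\: N) \in F).
Context (FaN : forall s v, s \in F -> a \in s -> v \in N -> v \notin s).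

Definition top_mass (y : V -> R) : R := \sum_(v in N) y v.

Definition collapse (y : V -> R) (w : V) : R :=
  if w == a then apex_weight (top_mass y)
  else if w \in N then top_weight (top_mass y) * y w
  else top_mass y * link_weight (top_mass y) * y w.

(* Moves [c <= 1/2] to [c = 0] inside the face carrying the point; it is an
   intermediate step because the straight line from [y] to [collapse y] leaves
   the complex (no face contains both the apex and a top). *)
Definition stretch (y : V -> R) (w : V) : R :=
  if w \in N then top_weight (top_mass y) * y w
  else stretch_weight (top_mass y) * y w.

Implicit Types x : realization R F.

Lemma rest_mass x : \sum_(v | v \notin N) bary x v = 1 - top_mass (bary x).
Proof.
have := bary_sum x; rewrite (bigID (fun v => v \in N)) /= => <-.
by rewrite addrAC subrr add0r.
Qed.

Lemma top_mass01 x : 0 <= top_mass (bary x) <= 1.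
Proof.
have : 0 <= \sum_(v | v \notin N) bary x v.
  by apply: sumr_ge0 => v _; exact: bary_ge0.
rewrite rest_mass subr_ge0 => ->; rewrite andbT.
by apply: sumr_ge0 => v _; exact: bary_ge0.
Qed.

Lemma top_mass_eq0 x v : top_mass (bary x) = 0 -> v \in N -> bary x v = 0.
Proof.
move=> /eqP; rewrite psumr_eq0; last by move=> w _; exact: bary_ge0.
by move=> /allP/(_ v (mem_index_enum v))/implyP h /h /eqP.
Qed.

(** No face contains the apex together with a top, so one of the factors vanishes. Hence overwriting
    the coordinate at [a] in [collapse] loses no mass: it would enter with the factor [top_mass]. *)
Lemma apex_top_mass x : top_mass (bary x) * bary x a = 0.
Proof.
have [->|xa] := eqVneq (bary x a) 0; first by rewrite mulr0.
rewrite /top_mass big1 ?mul0r // => v vN; apply/eqP.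
by have := FaN (bary_support x) (v := v); rewrite !inE negbK; exact.
Qed.

Lemma collapse_sum x : \sum_v collapse (bary x) v = 1.
Proof.
rewrite (bigID (fun v => v \in N)) /= (bigD1 a aN) /= {2}/collapse eqxx.
set c := top_mass _.
have -> : \sum_(v in N) collapse (bary x) v = top_weight c * c.
  rewrite /c {2}/top_mass mulr_sumr; apply: eq_bigr => v vN.
  rewrite /collapse vN; case: eqP => // va.
  by move: aN; rewrite -va vN.
have -> : \sum_(v | (v \notin N) && (v != a)) collapse (bary x) v =
    c * link_weight c * (1 - c).
  rewrite -rest_mass mulr_sumr (bigD1 a aN) /= mulrAC apex_top_mass mul0r add0r.
  apply: eq_bigr => v /andP[vN va].
  by rewrite /collapse (negbTE vN) (negbTE va).
by rewrite addrCA addrA collapse_weights // top_mass01.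
Qed.

Lemma stretch_sum x : \sum_v stretch (bary x) v = 1.
Proof.
rewrite (bigID (fun v => v \in N)) /=.
have <- := stretch_weights (top_mass01 x); rewrite -rest_mass; congr (_ + _).
  rewrite {2}/top_mass mulr_sumr; apply: eq_bigr => v vN.
  by rewrite /stretch vN.
by rewrite mulr_sumr; apply: eq_bigr => v vN; rewrite /stretch (negbTE vN).
Qed.

Lemma stretch_ge0 x v : 0 <= stretch (bary x) v.
Proof.
rewrite /stretch; case: ifP => _; rewrite mulr_ge0 ?bary_ge0 ?top_weight_ge0 //.
by rewrite ltW // stretch_weight_gt0.
Qed.

Lemma stretch_support x : Defs.support (stretch (bary x)) =
  if 2^-1 < top_mass (bary x) then Defs.support (bary x)
  else Defs.support (bary x) :\: N.
Proof.
apply/setP => v; rewrite inE /stretch.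
have t0 := top_weight_eq0 (top_mass (bary x)).
have s0 : stretch_weight (top_mass (bary x)) != 0.
  by rewrite gt_eqF // stretch_weight_gt0.
case: ifP => vN; rewrite mulf_eq0.
  rewrite t0; case: ltP => h; rewrite !inE ?vN //.
by rewrite (negbTE s0) /=; case: ltP => h; rewrite !inE ?vN.
Qed.

(** With [c] the top mass, the apex weight vanishes exactly from [c = 1/2] on, the factor of the
    tops exactly up to [c = 1/2], and the factor of the rest only at [c = 0]. When [c > 0], the
    point itself has no weight at [a], by [apex_top_mass]. *)
Lemma collapse_support x : Defs.support (collapse (bary x)) =
  if 2^-1 < top_mass (bary x) then Defs.support (bary x)
  else if top_mass (bary x) == 2^-1 then Defs.support (bary x) :\: N
  else if top_mass (bary x) == 0 then [set a]
  else a |: (Defs.support (bary x) :\: N).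
Proof.
have xa := apex_top_mass x.
have /andP[c0 _] := top_mass01 x.
have l0 c : link_weight c == 0 :> R = false by rewrite gt_eqF // link_weight_gt0.
apply/setP => v; rewrite inE /collapse; move: xa c0; set c := top_mass _ => xa c0.
have [->{v}|va] := eqVneq v a.
  rewrite apex_weight_eq0 -ltNge.
  case: (ltgtP c 2^-1) => h.
  - by case: ifP => _; rewrite !inE eqxx.
  - rewrite inE; apply/esym/negbTE; rewrite negbK; move/eqP: xa.
    rewrite mulf_eq0 => /orP[/eqP cz|//].
    by move: h; rewrite cz ltNge invr_ge0 ler0n.
  - rewrite !inE aN /=; apply/esym/negbTE; rewrite negbK; move/eqP: xa.
    rewrite mulf_eq0 h invr_eq0 pnatr_eq0 //=.
case: ifP => vN; rewrite !mulf_eq0 ?top_weight_eq0 ?l0 ?orbF.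
  case: (ltgtP c 2^-1) => h; rewrite ?inE ?vN //=.
  by case: ifP => _; rewrite !inE ?vN (negbTE va).
case: (ltgtP c 2^-1) => h; rewrite ?inE ?vN //=.
- by have [cz|cz] := eqVneq c 0; rewrite !inE (negbTE va) ?vN.
- by rewrite gt_eqF //; apply: le_lt_trans h; rewrite invr_ge0 ler0n.
- by rewrite h invr_eq0 pnatr_eq0.
Qed.

Lemma stretchP x : realization_set R F (stretch (bary x)).
Proof.
split; first exact: stretch_ge0.
split; first exact: stretch_sum.
rewrite stretch_support; have xF := bary_support x.
by case: ifP => // _; exact: FD.
Qed.

Lemma continuous_top_mass {X : topologicalType} (f : X -> V -> R) p :
  (forall v, {for p, continuous (fun q => f q v)}) ->
  {for p, continuous (fun q => top_mass (f q))}.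
Proof. by move=> fc; apply: continuous_bigsum => v _; exact: fc. Qed.

Lemma continuous_collapse {X : topologicalType} (f : X -> V -> R) p :
  (forall v, {for p, continuous (fun q => f q v)}) ->
  forall v, {for p, continuous (fun q => collapse (f q) v)}.
Proof.
move=> fc v; have mc := continuous_top_mass fc.
rewrite /collapse; case: (v == a); first exact: continuous_apex_weight.
case: (v \in N).
  by apply: continuous_mul => //; exact: continuous_top_weight.
apply: continuous_mul => //; apply: continuous_mul => //.
exact: continuous_link_weight.
Qed.

Lemma continuous_stretch {X : topologicalType} (f : X -> V -> R) p :
  (forall v, {for p, continuous (fun q => f q v)}) ->
  forall v, {for p, continuous (fun q => stretch (f q) v)}.
Proof.
move=> fc v; have mc := continuous_top_mass fc.
rewrite /stretch; case: (v \in N); apply: continuous_mul => //.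
  exact: continuous_top_weight.
exact: continuous_stretch_weight.
Qed.

(** Two straight lines, from the identity to the stretch and from there to the collapse. On the
    first the supports stay inside that of [x]; on the second they agree or differ only by adding
    the apex to a face without tops, or shrink to the apex inside such a face. Any map [phi] with
    the right coordinates is allowed, so that composites can be plugged in. *)
Lemma collapse_homotopic (phi : realization R F -> realization R F) :
  (forall x, bary (phi x) =1 collapse (bary x)) -> homotopic R phi idfun.
Proof.
move=> phiE; apply: homotopic_sym.
pose k x := point_of (stretchP x).
have kc : continuous k.
  by apply: continuous_realization => v p; apply: continuous_stretch => w;
    exact: continuous_bary.
apply: (homotopic_trans (g := k)); apply: homotopic_line => //.
- by move=> x; exact: cvg_id.
- move=> x; rewrite bary_point_of stretch_support; have xF := bary_support x.
  case: ifP => _; first by rewrite finset.setUid.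
  by rewrite (_ : _ :|: _ = Defs.support (bary x)) //; apply/finset.setUidPl/finset.subsetDl.
- apply: continuous_realization => v p.
  rewrite (_ : (fun _ => _) = fun x => collapse (bary x) v); last first.
    by apply/funext => x; exact: phiE.
  by apply: continuous_collapse => w; exact: continuous_bary.
- move=> x; rewrite bary_point_of.
  have -> : Defs.support (bary (phi x)) = Defs.support (collapse (bary x)).
    by apply/setP => v; rewrite !inE phiE.
  rewrite stretch_support collapse_support; have xF := bary_support x.
  case: ifP => _; first by rewrite finset.setUid.
  case: ifP => _; first by rewrite finset.setUid; exact: FD.
  case: ifP => _; first by rewrite finset.setUC; exact: Fa.
  by rewrite finset.setUCA finset.setUid; exact: Fa.
Qed.

End Collapse.

Section BigOption.
Context {R : realType}.

Lemma big_option (A : finType) (f : option A -> R) :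
  \sum_p f p = f None + \sum_x f (Some x).
Proof.
rewrite (bigD1 None) //=; congr (_ + _).
rewrite (reindex_omap Some id) => [|[x|] //]; apply: eq_bigl => x.
by rewrite /= eqxx.
Qed.

End BigOption.

Lemma in_Ind (T : finType) (e : rel T) (W s : {set T}) :
  reflect (s \subset W /\ {in s &, forall x y, ~~ e x y}) (s \in Ind e W).
Proof.
rewrite inE; apply: (iffP andP) => -[sW H]; split=> //.
  by move=> x y xs ys; exact: (forall_inP (forall_inP H x xs) y ys).
by apply/forall_inP => x xs; apply/forall_inP => y ys; exact: H.
Qed.

(** * Independent sets around a simplicial vertex *)

Section SimplicialNeighbourhood.
Context {R : realType} (T : finType) (e : rel T) (u : T).
Context (e_sym : symmetric e) (e_irr : irreflexive e).
Context (cliqueNu : forall v w,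
  v \in nbhd e u -> w \in nbhd e u -> v != w -> e v w).

Local Notation N := (nbhd e u).
Local Notation W v := (gminus (nbhd e u :|: nbhd e v)).
Local Notation X := (Ind e [set: T]).

Implicit Types (s : {set T}) (v w : T).

Lemma in_W v w : (w \in W v) = (w \notin N) && (w \notin nbhd e v).
Proof. by rewrite !inE negb_or. Qed.

Lemma apex_notin_N : u \notin N.
Proof. by rewrite inE e_irr. Qed.

Lemma apex_notin_W v : v \in N -> u \notin W v.
Proof. by rewrite inE => uv; rewrite !inE e_sym uv orbT. Qed.

Lemma top_notin_W v w : v \in N -> v \notin W w.
Proof. by move=> vN; rewrite in_W vN. Qed.

Lemma Ind_W_notin v s w : s \in Ind e (W v) -> w \in N -> w \notin s.
Proof.
move=> /in_Ind[/fintype.subsetP sW _] wN; apply/negP => /sW.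
exact/negP/top_notin_W.
Qed.

Lemma IndT_sub s (t : {set T}) : t \subset s -> s \in X -> t \in X.
Proof.
move=> /fintype.subsetP ts /in_Ind[_ H]; apply/in_Ind; split.
  exact: finset.subsetT.
by move=> x y /ts xs /ts ys; exact: H.
Qed.

Lemma IndT_set0 : finset.set0 \in X.
Proof. by apply/in_Ind; split=> [|x y]; rewrite ?finset.sub0set ?inE. Qed.

Lemma IndT_setU1 v s : s \in X -> {in s, forall w, ~~ e v w} -> v |: s \in X.
Proof.
move=> /in_Ind[_ H] vs; apply/in_Ind; split; first exact: finset.subsetT.
move=> x y; rewrite !inE => /orP[/eqP->|xs] /orP[/eqP->|ys].
- by rewrite e_irr.
- exact: vs.
- by rewrite e_sym; exact: vs.
- exact: H.
Qed.

Lemma IndT_of_Ind (A : {set T}) s : s \in Ind e A -> s \in X.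
Proof.
by move=> /in_Ind[_ H]; apply/in_Ind; split=> //; exact: finset.subsetT.
Qed.

Lemma IndT_setD s : s \in X -> s :\: N \in X.
Proof. by apply: IndT_sub; exact: finset.subsetDl. Qed.

Lemma IndT_apex s : s \in X -> u |: (s :\: N) \in X.
Proof.
move=> sX; apply: IndT_setU1; first exact: IndT_setD.
by move=> w; rewrite !inE => /andP[].
Qed.

Lemma IndT_apex_top s v : s \in X -> u \in s -> v \in N -> v \notin s.
Proof.
move=> /in_Ind[_ H] us; rewrite inE => uv; apply/negP => vs.
by have := H u v us vs; rewrite uv.
Qed.

(** The clique hypothesis enters here: it makes the cones with tops in [N] meet only along faces
    without tops. *)
Lemma IndT_top_uniq s v w :
  s \in X -> v \in N -> w \in N -> v \in s -> w \in s -> v = w.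
Proof.
move=> /in_Ind[_ H] vN wN vs ws; apply/eqP; apply/negPn/negP => vw.
by have := H v w vs ws; rewrite cliqueNu.
Qed.

Lemma IndT_link s v : s \in X -> v \in s -> s :\: N \in Ind e (W v).
Proof.
move=> /in_Ind[_ H] vs; apply/in_Ind; split; last first.
  by move=> x y; rewrite !inE => /andP[_ xs] /andP[_ ys]; exact: H.
apply/fintype.subsetP => w; rewrite in_W !inE => /andP[-> ws] /=.
exact: H.
Qed.

Lemma IndT_cone_apex v s : v \in N -> s \in Ind e (W v) -> u |: s \in X.
Proof.
move=> vN sW; apply: IndT_setU1; first exact: IndT_of_Ind sW.
move: sW => /in_Ind[/fintype.subsetP sW _] w /sW.
by rewrite in_W !inE => /andP[].
Qed.

Lemma IndT_cone_top v s : s \in Ind e (W v) -> v |: s \in X.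
Proof.
move=> sW; apply: IndT_setU1; first exact: IndT_of_Ind sW.
move: sW => /in_Ind[/fintype.subsetP sW _] w /sW.
by rewrite in_W !inE => /andP[].
Qed.

(** * Faces of the wedge of suspensions *)

Local Notation Y := (wedge_cx N (fun v => susp (Ind e (W v))) (fun _ => inr true)).
Local Notation WV := (option (T * (T + bool))).

Definition south (v : T) : WV := Some (v, inr false).
Definition copy (v : T) (w : T) : WV := Some (v, inl w).
Definition souths : {set WV} := [set south v | v in N].

(** Gluing turns every north pole into [None], so a vertex [Some (v, inr true)] lies in no face. The
    first two cases keep the base point available when [N] is empty. *)
Inductive wedge_face : {set WV} -> Prop :=
| WedgeEmpty : wedge_face finset.set0
| WedgeBase : wedge_face [set None]
| WedgeLink v s of v \in N & s \in Ind e (W v) : wedge_face (copy v @: s)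
| WedgeNorth v s of v \in N & s \in Ind e (W v) :
    wedge_face (None |: copy v @: s)
| WedgeSouth v s of v \in N & s \in Ind e (W v) :
    wedge_face (south v |: copy v @: s).

Lemma wedge_faceP t : (t \in Y) <-> wedge_face t.
Proof.
pose j v : T + bool -> WV := wedge_inj (fun _ : T => inr true) v.
have jl v s : j v @: (inl @: s) = copy v @: s.
  by rewrite -imset_comp; apply: eq_imset => w.
have jU v p s : j v @: (p |: inl @: s) = j v p |: copy v @: s.
  by rewrite imsetU1 jl.
have jN v : j v (inr true) = None by rewrite /j /wedge_inj eqxx.
have jS v : j v (inr false) = south v by [].
split.
  rewrite !inE => /orP[/orP[]/eqP->|]; [exact: WedgeEmpty|exact: WedgeBase|].
  case/exists_inP => v vN /exists_inP[q]; rewrite inE => /exists_inP[s sW].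
  case/or3P => /eqP-> /eqP->; rewrite -/(j v) ?jl ?jU ?jN ?jS.
  - exact: WedgeLink.
  - exact: WedgeNorth.
  - exact: WedgeSouth.
have suspY v q : v \in N -> q \in susp (Ind e (W v)) -> j v @: q \in Y.
  move=> vN qS; rewrite !inE; apply/orP; right; apply/exists_inP; exists v => //.
  by apply/exists_inP; exists q.
case=> [||v s vN sW|v s vN sW|v s vN sW].
- by rewrite !inE eqxx.
- by rewrite !inE eqxx orbT.
- rewrite -jl; apply: suspY => //; rewrite inE; apply/exists_inP; exists s => //.
  by rewrite eqxx.
- rewrite -(jN v) -jU; apply: suspY => //; rewrite inE; apply/exists_inP.
  by exists s; rewrite ?eqxx ?orbT.
- rewrite -jS -jU; apply: suspY => //; rewrite inE; apply/exists_inP.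
  by exists s; rewrite ?eqxx ?orbT.
Qed.

Lemma mem_souths p :
  (p \in souths) = if p is Some (v, inr false) then v \in N else false.
Proof.
apply/imsetP/idP => [[v vN ->] //|].
by case: p => [[v [w|[]]]|] // vN; exists v.
Qed.

Lemma mem_copy v s p :
  (p \in copy v @: s) = if p is Some (v', inl w) then (v' == v) && (w \in s) else false.
Proof.
apply/imsetP/idP => [[w ws ->]|]; first by rewrite /= eqxx.
by case: p => [[v' [w|b]]|] // /andP[/eqP-> ws]; exists w.
Qed.

(** Together with [wedge_base_south], this supplies the hypotheses of the collapse for the apex
    [None] and the tops [souths]. *)
Lemma wedge_setD_souths t : t \in Y -> wedge_face (t :\: souths) /\
  wedge_face (None |: (t :\: souths)).
Proof.
have linkD v s : copy v @: s :\: souths = copy v @: s.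
  apply/setP => p; rewrite !inE mem_souths mem_copy.
  by case: p => [[v' [w|[]]]|]; rewrite ?andbF.
have noneD A : (None |: A) :\: souths = None |: (A :\: souths).
  by apply/setP => p; rewrite !inE mem_souths; case: p.
move/wedge_faceP; case=> [||v s vN sW|v s vN sW|v s vN sW].
- by rewrite finset.set0D finset.setU0; split; constructor.
- have -> : [set None] :\: souths = [set None] :> {set WV}.
    by rewrite -[[set None]]finset.setU0 noneD finset.set0D.
  by rewrite finset.setUid; split; constructor.
- by rewrite linkD; split; constructor.
- by rewrite noneD linkD finset.setUA finset.setUid; split; constructor.
- have -> : (south v |: copy v @: s) :\: souths = copy v @: s.
    rewrite -[RHS]linkD; apply/setP => p; rewrite !inE mem_souths.
    by have [->|] := eqVneq p (south v); rewrite //= vN.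
  by split; constructor.
Qed.

Lemma wedge_base_south t p : t \in Y -> None \in t -> p \in souths -> p \notin t.
Proof.
move=> /wedge_faceP tY; rewrite mem_souths; case: p => [[v [w|[]]]|] //.
case: tY => [||v' s _ _|v' s _ _|v' s _ _]; rewrite ?inE ?mem_copy ?orbF //.
Qed.

Lemma wedge_north t v : t \in Y -> Some (v, inr true) \notin t.
Proof.
move=> /wedge_faceP; case=> [||v' s _ _|v' s _ _|v' s _ _];
by rewrite ?inE ?mem_copy ?orbF //=; apply/negP => /eqP.
Qed.

Lemma wedge_branch t v q : t \in Y -> Some (v, q) \in t -> v \in N.
Proof.
move=> /wedge_faceP; case=> [||v' s vN _|v' s vN _|v' s vN _];
  rewrite ?finset.in_setU1 ?finset.in_set1 ?finset.in_set0 ?mem_copy ?orbF //=.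
- by case: q => // w /andP[/eqP->].
- by case: q => // w /andP[/eqP->].
- by case: q => [w|b] /orP[/eqP[->]//|] // /andP[/eqP->].
Qed.

Lemma wedge_copy t v w : t \in Y -> copy v w \in t -> w \in W v.
Proof.
move=> /wedge_faceP; case=> [||v' s vN sW|v' s vN sW|v' s vN sW];
  rewrite ?finset.in_setU1 ?finset.in_set1 ?finset.in_set0 ?mem_copy //;
  move: sW => /in_Ind[/fintype.subsetP sW _].
- by move=> /andP[/eqP-> /sW].
- by move=> /orP[/eqP//|/andP[/eqP-> /sW]].
- by move=> /orP[/eqP//|/andP[/eqP-> /sW]].
Qed.

Lemma wedge_south t v v' q :
  t \in Y -> south v \in t -> Some (v', q) \in t -> v' = v.
Proof.
move=> /wedge_faceP; case=> [||w s _ _|w s _ _|w s _ _];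
  rewrite ?finset.in_setU1 ?finset.in_set1 ?finset.in_set0 ?mem_copy ?orbF //= => /eqP[->].
by case: q => [z|b] /orP[/eqP[->]//|] // /andP[/eqP->].
Qed.

(** * The two maps of the homotopy equivalence *)

Definition unwedge (p : WV) : T :=
  match p with
  | Some (_, inl w) => w
  | Some (v, inr false) => v
  | _ => u
  end.

(** This is the collapse with its link term distributed over the branches: the factor [c] in
    [c * link_weight c * x w] is the sum of the [x v], and branch [v] receives the share of [x v].
    No choice of the top carrying [x] is made, so continuity is visible. *)
Definition to_wedge (x : T -> R) (p : WV) : R :=
  let c := top_mass N x in
  match p with
  | None => apex_weight c
  | Some (v, inl w) =>
      if (v \in N) && (w \notin N) then x v * link_weight c * x w else 0
  | Some (v, inr false) => if v \in N then top_weight c * x v else 0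
  | Some (v, inr true) => 0
  end.

Lemma push_unwedge (y : WV -> R) z : (forall v, y (Some (v, inr true)) = 0) ->
  push unwedge y z =
  (if z == u then y None else 0) + (\sum_v y (copy v z) + y (south z)).
Proof.
move=> yn; rewrite /push big_mkcond big_option /= eq_sym; congr (_ + _).
transitivity (\sum_v \sum_q if unwedge (Some (v, q)) == z
  then y (Some (v, q)) else 0).
  by rewrite pair_bigA; apply: eq_bigr => -[].
have big_inl_inr (f : T + bool -> R) :
    \sum_q f q = \sum_w f (inl w) + \sum_b f (inr b).
  exact: big_sumType.
under [LHS]eq_bigr => v _ do rewrite big_inl_inr /=.
rewrite big_split /=; congr (_ + _).
  apply: eq_bigr => v _; rewrite -big_mkcond /=.
  by rewrite (big_pred1 z).
under [LHS]eq_bigr => v _ do rewrite big_bool /= yn if_same add0r.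
by rewrite -big_mkcond /= (big_pred1 z).
Qed.

Section ToWedge.
Context (x : T -> R) (xX : realization_set R X x).

Lemma top_neq0 v : v \in N -> x v != 0 -> top_mass N x = x v.
Proof.
case: xX => _ [_ sX] vN xv; rewrite /top_mass (bigD1 v) //= big1 ?addr0 //.
move=> w /andP[wN wv]; apply/eqP; apply: contraNT wv => xw.
by apply/eqP; apply: IndT_top_uniq sX _ _ _ _ => //; rewrite inE.
Qed.

Lemma unwedge_to_wedge : push unwedge (to_wedge x) =1 collapse u N x.
Proof.
move=> z; rewrite push_unwedge // /collapse /=.
have c0 := apex_top_mass (@IndT_apex_top) (point_of xX).
have -> : (\sum_v if (v \in N) && (z \notin N) then
    x v * link_weight (top_mass N x) * x z else 0) =
    if z \in N then 0 else top_mass N x * link_weight (top_mass N x) * x z.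
  case: ifP => zN; first by rewrite big1 // => v _; rewrite andbF.
  rewrite -big_mkcondr /= -mulr_suml -mulr_suml; congr (_ * _ * _).
  by apply: eq_bigl => v; rewrite andbT.
(* At [u] the branches contribute [c * link_weight c * x u], which is 0 because a point with weight
   at [u] has no top. *)
have [->|zu] := eqVneq z u.
  rewrite (negbTE apex_notin_N) addr0 mulrAC -[x u]/(bary (point_of xX) u).
  by rewrite c0 mul0r addr0.
by rewrite add0r; case: ifP => _; rewrite ?add0r ?addr0.
Qed.

(** If [c = 0] the image is the base point. Otherwise a single top [v] carries all of [c], the image
    lies in branch [v], and comparing [c] with [1/2] tells whether the base point, the south pole or
    neither joins the copy of the link face. *)
Lemma to_wedge_realization : realization_set R Y (to_wedge x).
Proof.
have x0 v : 0 <= x v by case: xX.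
have sX : Defs.support x \in X by case: xX => _ [].
have c0 : 0 <= top_mass N x by exact: sumr_ge0.
have l0 c : link_weight c == 0 :> R = false by rewrite gt_eqF // link_weight_gt0.
split=> [[[v [w|[]]]|] //=|].
- by case: ifP => // _; rewrite !mulr_ge0 // ltW // link_weight_gt0.
- by case: ifP => // _; rewrite mulr_ge0 // top_weight_ge0.
- exact: apex_weight_ge0.
split.
  (* Pushing preserves the total weight, so it can be computed on the collapse. *)
  rewrite -(push_sum unwedge); under eq_bigr do rewrite unwedge_to_wedge.
  exact: (collapse_sum apex_notin_N (@IndT_apex_top) (point_of xX)).
apply/wedge_faceP.
have [cz|cn0] := eqVneq (top_mass N x) 0.
  suff -> : Defs.support (to_wedge x) = [set None] by constructor.
  have xN v : v \in N -> x v = 0 by exact: (@top_mass_eq0 _ _ _ _ (point_of xX)).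
  apply/setP => p; rewrite [LHS]inE finset.in_set1 /to_wedge cz apex_weight0.
  case: p => [[v [w|[]]]|]; rewrite ?eqxx ?oner_neq0 //.
    by case: ifP => [/andP[/xN -> _]|_]; rewrite ?mul0r eqxx.
  by case: ifP => [/xN ->|_]; rewrite ?mulr0 eqxx.
have [v vN xv] : exists2 v, v \in N & x v != 0.
  apply/exists_inP; apply: contraNT cn0 => /exists_inPn h.
  by apply/eqP; rewrite /top_mass big1 // => v /h; rewrite negbK => /eqP.
have cE := top_neq0 vN xv.
pose s := Defs.support x :\: N.
have sW : s \in Ind e (W v) by apply: IndT_link => //; rewrite inE.
(* A nonzero coordinate in branch [v'] needs [x v'] nonzero, and two tops in one face coincide. *)
have linkE v' w : (to_wedge x (copy v' w) != 0) = (copy v' w \in copy v @: s).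
  rewrite mem_copy /=.
  have -> : (w \in s) = (w \notin N) && (x w != 0) 
    by rewrite finset.in_setD [w \in Defs.support _]inE.
  have [->|vv] /= := eqVneq v' v.
    rewrite vN /=; case: ifP => // _; last by rewrite eqxx.
    by rewrite !mulf_eq0 l0 (negbTE xv).
  case: ifP => [/andP[v'N _]|_]; last by rewrite eqxx.
  apply/negbTE; rewrite negbK !mulf_eq0; apply/orP; left; apply/orP; left.
  apply: contraNT vv => xv'; apply/eqP.
  by apply: IndT_top_uniq sX v'N vN _ _; rewrite inE.
have [ch|ch|ch] := ltgtP (top_mass N x) 2^-1.
- suff -> : Defs.support (to_wedge x) = None |: copy v @: s by exact: WedgeNorth.
  apply/setP => p; rewrite inE finset.in_setU1.
  case: p => [[v' [w|[]]]|]; rewrite ?linkE // ?mem_copy ?eqxx //=.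
    by case: ifP => _; rewrite ?eqxx // mulf_eq0 top_weight_eq0 ltW.
  by rewrite apex_weight_eq0 -ltNge ch.
- suff -> : Defs.support (to_wedge x) = south v |: copy v @: s.
    exact: WedgeSouth.
  apply/setP => p; rewrite inE finset.in_setU1.
  case: p => [[v' [w|[]]]|]; rewrite ?linkE // ?mem_copy ?eqxx //=.
  + by rewrite (negbTE (_ : Some (v', inl w) != south v)) //; apply/eqP.
  + by rewrite orbF; apply/esym/negbTE/eqP.
  + rewrite orbF; case: ifP => v'N; last first.
      rewrite eqxx; apply/esym/negbTE/eqP => -[vv].
      by rewrite vv vN in v'N.
    rewrite mulf_eq0 top_weight_eq0 leNgt ch /=.
    apply/idP/eqP => [xv'|[->] //].
    by congr (south _); apply: IndT_top_uniq sX v'N vN _ _; rewrite inE.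
  + by apply/negbTE; rewrite negbK apex_weight_eq0 ltW.
- suff -> : Defs.support (to_wedge x) = copy v @: s by exact: WedgeLink.
  apply/setP => p; rewrite inE.
  case: p => [[v' [w|[]]]|]; rewrite ?linkE // ?mem_copy ?eqxx //=.
    by case: ifP => _; rewrite ?eqxx // mulf_eq0 top_weight_eq0 ch lexx.
  by apply/negbTE; rewrite negbK apex_weight_eq0 ch.
Qed.

End ToWedge.

Lemma unwedge_face (t : {set WV}) : t \in Y -> unwedge @: t \in X.
Proof.
have unlink v (s : {set T}) : unwedge @: (copy v @: s) = s.
  by rewrite -imset_comp -[RHS]imset_id; apply: eq_imset.
move/wedge_faceP; case=> [||v s vN sW|v s vN sW|v s vN sW].
- by rewrite imset0; exact: IndT_set0.
- rewrite imset_set1; have := IndT_apex IndT_set0.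
  by rewrite finset.set0D finset.setU0.
- by rewrite unlink; exact: IndT_of_Ind sW.
- by rewrite imsetU1 unlink; exact: IndT_cone_apex vN sW.
- by rewrite imsetU1 unlink; exact: IndT_cone_top.
Qed.

(** Forgetting the branch loses nothing that the collapse retains: a face with a south pole lies in
    the branch of that pole, so the weight of the pole identifies the branch, and without south
    poles the collapse only keeps the base point. *)
Lemma to_wedge_unwedge (y : WV -> R) : realization_set R Y y ->
  to_wedge (push unwedge y) =1 collapse None souths y.
Proof.
move=> [y0 [y1 sY]].
have yP p : p \notin Defs.support y -> y p = 0.
  by rewrite inE negbK => /eqP.
have yN v : y (Some (v, inr true)) = 0 by apply/yP/wedge_north.
have yb v q : v \notin N -> y (Some (v, q)) = 0.
  by move=> vN; apply: yP; apply: contra vN; exact: wedge_branch.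
have yc v w : w \notin W v -> y (copy v w) = 0.
  by move=> wW; apply: yP; apply: contra wW; exact: wedge_copy.
have xN v : v \in N -> push unwedge y v = y (south v).
  move=> vN; rewrite push_unwedge // big1 ?add0r => [|w _].
    case: eqP => [vu|_]; last by rewrite add0r.
    by move: vN; rewrite vu (negbTE apex_notin_N).
  by apply: yc; exact: top_notin_W.
have cE : top_mass N (push unwedge y) = top_mass souths y.
  rewrite /top_mass big_imset /=; last by move=> v w _ _ [].
  exact: eq_bigr.
move=> [[v [w|[]]]|]; rewrite /to_wedge /collapse /= ?cE ?mem_souths //.
- set c := top_mass _ _; have [vN|vN] /= := boolP (v \in N); last first.
    by rewrite yb ?mulr0.
  have [wN|wN] /= := boolP (w \in N).
    by rewrite [y _]yc ?mulr0 // top_notin_W.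
  (* If the pole of branch [v] has weight 0 while a copy in that branch has weight, no other pole
     can have weight; then [c = 0] and both sides vanish. *)
  rewrite xN //; have [yv|yv] := eqVneq (y (south v)) 0.
    rewrite yv !mul0r; have [->|yvw] := eqVneq (y (Some (v, inl w))) 0.
      by rewrite mulr0.
    suff -> : c = 0 by rewrite !mul0r.
    rewrite /c -cE /top_mass big1 // => v' v'N; rewrite xN //; apply/eqP.
    apply/negPn/negP => yv'.
    have := @wedge_south _ v' v (inl w) sY.
    rewrite !inE => /(_ yv' yvw) vv.
    by rewrite -vv yv eqxx in yv'.
  have only v' q : v' != v -> y (Some (v', q)) = 0.
    move=> vv; apply: yP; apply: contra vv => yv'; apply/eqP.
    by apply: wedge_south sY _ yv'; rewrite inE.
  have -> : c = y (south v).
    rewrite /c -cE /top_mass (bigD1 v) //= xN // big1 ?addr0 // => v'.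
    by case/andP=> v'N vv; rewrite xN // [LHS]only.
  congr (_ * _); rewrite push_unwedge // (bigD1 v) //= big1 => [|v' vv]; last first.
    exact: only.
  rewrite [y (south w)]yb // !addr0; case: ifP => _; rewrite ?add0r //.
  (* The remaining term, for [w = u], is the weight of the base point, excluded by the south pole of
     [v]. *)
  rewrite yP ?add0r //; apply: contra yv => yNone; apply/eqP/yP.
  by apply: wedge_base_south sY yNone _; rewrite mem_souths.
- by rewrite yN mulr0.
- by case: ifP => vN; rewrite ?xN // [y _]yb ?vN ?mulr0.
Qed.

Lemma Ind_wedge_equivalent :
  homotopy_equivalent R (realization R X) (realization R Y).
Proof.
pose f (x : realization R X) := point_of (to_wedge_realization (baryP x)).
pose g (y : realization R Y) :=
  point_of (push_realization unwedge_face (baryP y)).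
exists f, g; split; [|split; [|split]].
- apply: continuous_realization => p; apply: continuous_for => x.
  have xc w : {for x, continuous (fun z : realization R X => bary z w)}.
    exact: continuous_bary.
  have mc := continuous_top_mass (N := N) xc.
  change {for x, continuous (fun z : realization R X => to_wedge (bary z) p)}.
  rewrite /to_wedge; case: p => [[v [w|[]]]|].
  + case: ((v \in N) && (w \notin N)); last exact: continuous_const.
    apply: continuous_mul; last exact: xc.
    apply: continuous_mul; first exact: xc.
    exact: continuous_link_weight.
  + exact: continuous_const.
  + case: (v \in N); last exact: continuous_const.
    by apply: continuous_mul; [exact: continuous_top_weight | exact: xc].
  + exact: continuous_apex_weight.
- apply: continuous_realization => v; apply: continuous_for => y.
  by apply: continuous_push => p; exact: continuous_bary.
- apply: (@collapse_homotopic _ _ _ u N).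
  + exact: apex_notin_N.
  + exact: IndT_setD.
  + exact: IndT_apex.
  + exact: IndT_apex_top.
  + by move=> x v; exact: (unwedge_to_wedge (baryP x)).
- apply: (@collapse_homotopic _ _ _ None souths).
  + by rewrite mem_souths.
  + by move=> s /wedge_setD_souths[/wedge_faceP].
  + by move=> s /wedge_setD_souths[_ /wedge_faceP].
  + exact: wedge_base_south.
  + by move=> y p; exact: (to_wedge_unwedge (baryP y)).
Qed.

(** * The complex without the generating faces *)

Section GeneratingFaces.
Context (Gf : T -> {set {set T}}).
Context (GfP : forall v, v \in N -> W v != finset.set0 ->
  generating_faces R (Ind e (W v)) (Gf v)).

Local Notation L v := (Ind e (W v) :\: Gf v).
Local Notation Gens :=
  ([set [set v] | v in N & W v == finset.set0] :|:
   [set t : {set T} | [exists v in N, (W v != finset.set0) &&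
      [exists s in Gf v, t == v |: s]]]).
Local Notation K := (X :\: Gens).

Lemma GensP (t : {set T}) : reflect
  ((exists v, [/\ v \in N, W v = finset.set0 & t = [set v]]) \/
   exists v s, [/\ v \in N, W v != finset.set0, s \in Gf v & t = v |: s])
  (t \in Gens).
Proof.
rewrite finset.in_setU [X in _ || X]inE; apply: (iffP orP).
  case=> [/imsetP[v]|/exists_inP[v vN /andP[W0 /exists_inP[s sG /eqP->]]]].
    by rewrite finset.in_set => /andP[vN /eqP W0 ->]; left; exists v.
  by right; exists v, s.
case=> [[v [vN W0 ->]]|[v [s [vN W0 sG ->]]]].
  by left; apply: imset_f; rewrite finset.in_set vN W0 eqxx.
right; apply/exists_inP; exists v => //; rewrite W0; apply/exists_inP.
by exists s.
Qed.

Lemma Gf_maximal v s : v \in N -> W v != finset.set0 -> s \in Gf v ->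
  s \in Ind e (W v) /\
  forall t : {set T}, t \in Ind e (W v) -> s \subset t -> t = s.
Proof.
move=> vN W0 sG; have [/(_ s sG) /andP[sI /forall_inP smax] _] := GfP vN W0.
by split=> // t tI st; apply/eqP/(implyP (smax t tI)).
Qed.

Lemma Gens_top (t : {set T}) : t \in Gens -> exists2 v, v \in N & v \in t.
Proof.
by case/GensP=> [[v [vN _ ->]]|[v [s [vN _ _ ->]]]]; exists v;
  rewrite ?finset.in_setU1 ?finset.in_set1 ?eqxx.
Qed.

Lemma K_no_top s : s \in X -> {in N, forall v, v \notin s} -> s \in K.
Proof.
move=> sX sN; rewrite finset.in_setD sX andbT; apply/negP => /Gens_top[v vN].
exact/negP/sN.
Qed.

(** A vertex of [W v] gives a larger face, so the empty face is not maximal and cannot have been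
    removed. This keeps the vertex [v] itself in [K]. *)
Lemma link_set0 v : v \in N -> W v != finset.set0 -> finset.set0 \in L v.
Proof.
move=> vN W0; rewrite finset.in_setD; apply/andP; split; last first.
  by apply/in_Ind; split=> [|x y]; rewrite ?finset.sub0set ?inE.
apply/negP => /(Gf_maximal vN W0)[_ max0].
have [w wW] := finset.set0Pn _ W0.
have : [set w] \in Ind e (W v).
  apply/in_Ind; split; first by rewrite finset.sub1set.
  by move=> x y /finset.set1P-> /finset.set1P->; rewrite e_irr.
move=> /max0 /(_ (finset.sub0set _)) /setP /(_ w).
by rewrite finset.in_set1 eqxx finset.in_set0.
Qed.

Lemma link_notin v s w : s \in L v -> w \in N -> w \notin s.
Proof. by rewrite finset.in_setD => /andP[_ sI]; exact: Ind_W_notin sI. Qed.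

Lemma apex_link v s : v \in N -> s \in L v -> u \notin s.
Proof.
move=> vN; rewrite finset.in_setD => /andP[_ /in_Ind[/fintype.subsetP sW _]].
by apply/negP => /sW; apply/negP; exact: apex_notin_W.
Qed.

Lemma K_link v s : v \in N -> s \in L v -> s \in K.
Proof.
move=> vN sL; apply: K_no_top => [|w wN]; last exact: link_notin sL wN.
by move: sL; rewrite finset.in_setD => /andP[_ sI]; exact: IndT_of_Ind sI.
Qed.

Lemma K_cone_apex v s : v \in N -> s \in L v -> u |: s \in K.
Proof.
move=> vN sL; apply: K_no_top => [|w wN].
  by move: sL; rewrite finset.in_setD => /andP[_ sI]; exact: IndT_cone_apex sI.
rewrite finset.in_setU1 negb_or (link_notin sL wN) andbT.
by apply: contraTneq wN => ->; exact: apex_notin_N.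
Qed.

Lemma setU1_top_inj v v' s (s' : {set T}) : {in N, forall w, w \notin s} ->
  {in N, forall w, w \notin s'} -> v \in N -> v' \in N ->
  v |: s = v' |: s' -> v = v' /\ s = s'.
Proof.
move=> sN s'N vN v'N /setP E.
have vv : v = v'.
  have := E v; rewrite !finset.in_setU1 eqxx (negbTE (s'N v vN)) orbF.
  by move=> /esym/eqP.
split=> //; apply/setP => w; have := E w; rewrite -vv !finset.in_setU1.
by have [->|//] := eqVneq w v; rewrite (negbTE (sN v vN)) (negbTE (s'N v vN)).
Qed.

(** A face with a top splits uniquely as that top and a face of its link, so [v |: s] could only be
    removed on account of [s] being in [Gf v]. *)
Lemma K_cone_top v s :
  v \in N -> W v != finset.set0 -> s \in L v -> v |: s \in K.
Proof.
move=> vN W0 sL; have sN w : w \in N -> w \notin s by exact: link_notin sL.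
move: sL; rewrite !finset.in_setD => /andP[sG sI].
rewrite (IndT_cone_top sI) andbT.
apply/negP => /GensP[[v' [v'N W'0]]|[v' [s' [v'N W'0 s'G]]]].
  rewrite -[[set v']]finset.setU0.
  case/(setU1_top_inj sN _ vN v'N) => [w _|vv _]; first by rewrite finset.in_set0.
  by rewrite vv W'0 eqxx in W0.
have s'N w : w \in N -> w \notin s'.
  by apply: Ind_W_notin; exact: (Gf_maximal v'N W'0 s'G).1.
case/(setU1_top_inj sN s'N vN v'N) => vv ss.
by rewrite ss vv s'G in sG.
Qed.

(** The top [v] is unique, so [s] is the cone from [v] over [s :\: N]. With [W v] empty this would
    be the removed face [[set v]], and with [s :\: N] in [Gf v] it would be removed too. *)
Lemma K_top s v : s \in K -> v \in N -> v \in s ->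
  W v != finset.set0 /\ s :\: N \in L v.
Proof.
rewrite finset.in_setD => /andP[sG sX] vN vs.
have sE : s = v |: (s :\: N).
  apply/setP => w; rewrite finset.in_setU1 finset.in_setD.
  have [->|wv] /= := eqVneq w v; first by rewrite vs.
  have [wN|//] /= := boolP (w \in N); apply/negbTE; apply: contra wv => ws.
  by apply/eqP; exact: IndT_top_uniq sX wN vN ws vs.
have sI := IndT_link sX vs.
have W0 : W v != finset.set0.
  apply/negP => /eqP W0; case/negP: sG; apply/GensP; left; exists v; split=> //.
  rewrite {1}sE; move: sI => /in_Ind[+ _]; rewrite W0 finset.subset0 => /eqP->.
  by rewrite finset.setU0.
split=> //; rewrite finset.in_setD sI andbT; apply/negP => sGf.
by case/negP: sG; apply/GensP; right; exists v, (s :\: N).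
Qed.

Lemma K_sub s : s \in K -> s \in X.
Proof. by rewrite finset.in_setD => /andP[]. Qed.

Lemma K_realization x : realization_set R K x -> realization_set R X x.
Proof. by case=> x0 [x1 /K_sub]. Qed.

(* The point of the join of the cones [u * L v * v], [v \in N], whose
   suspension coordinate is [y v] and whose component in [L v] is [m v]. *)
Definition joined (y : T -> R) (m : T -> T -> R) (w : T) : R :=
  let c := top_mass N y in
  if w == u then apex_weight c
  else if w \in N then top_weight c * y w
  else \sum_(v in N) link_weight c * (y v * (1 - c) * m v w).

Lemma joined_realization (y : T -> R) (m : T -> T -> R) :
  {in N, forall v, 0 <= y v} -> top_mass N y <= 1 ->
  {in N &, forall v w, y v != 0 -> y w != 0 -> v = w} ->
  (forall v, v \in N -> y v != 0 ->
     W v != finset.set0 /\ realization_set R (L v) (m v)) ->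
  realization_set R K (joined y m).
Proof.
move=> y0 c1 yuniq mL; have c0 : 0 <= top_mass N y by exact: sumr_ge0.
have sum_eq (k : T) : \sum_w (w == k)%:R = 1 :> R.
  by rewrite (bigD1 k) //= eqxx big1 ?addr0 // => w /negbTE->.
(* With all coordinates [y v] zero the joined point is the vertex [u]. *)
have [yN0|] := boolP [forall v in N, y v == 0].
  have yz v : v \in N -> y v = 0 by move=> vN; exact/eqP/(forall_inP yN0).
  have cz : top_mass N y = 0 by rewrite /top_mass big1.
  have jE w : joined y m w = (w == u)%:R.
    rewrite /joined cz apex_weight0; case: eqP => // _.
    case: ifP => [wN|_]; first by rewrite yz ?mulr0.
    by rewrite big1 // => v vN; rewrite yz // !mul0r mulr0.
  split=> [w|]; first by rewrite jE ler0n.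
  split; first by under eq_bigr do rewrite jE.
  have -> : Defs.support (joined y m) = u |: finset.set0.
    apply/setP => w; rewrite finset.in_setU1 finset.in_set0 orbF inE jE.
    by case: (w == u); rewrite ?oner_eq0 ?eqxx.
  apply: K_no_top => [|w wN].
    by have := IndT_apex IndT_set0; rewrite finset.set0D.
  rewrite finset.setU0 finset.in_set1.
  by apply: contraTneq wN => ->; exact: apex_notin_N.
case/forall_inPn => v vN yv; have [W0 [m0 [m1 sL]]] := mL v vN yv.
have cE : top_mass N y = y v.
  rewrite /top_mass (bigD1 v) //= big1 ?addr0 // => w /andP[wN wv].
  by apply/eqP; apply: contraNT wv => yw; apply/eqP; exact: yuniq.
move: c0 c1; set c := top_mass N y => c0 c1.
have yw w : w \in N -> w != v -> y w = 0.
  move=> wN wv; apply/eqP; apply: contraNT wv => ywn.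
  by apply/eqP; exact: yuniq.
have mz w : w \notin Defs.support (m v) -> m v w = 0.
  by rewrite inE negbK => /eqP.
have uv : u != v by apply: contraTneq vN => <-; exact: apex_notin_N.
(* Only the top [v] contributes, so the point is a combination of [u], [v] and [m v] with the
   weights of [collapse_weights]. *)
have jE w : joined y m w =
    apex_weight c * (w == u)%:R + top_weight c * c * (w == v)%:R +
    c * link_weight c * (1 - c) * m v w.
  rewrite /joined -/c; have [->|wu] := eqVneq w u.
    rewrite (negbTE uv) mz ?(apex_link vN sL) // !mulr0 mulr1; lra.
  rewrite mulr0 add0r; have [wN|wN] := boolP (w \in N).
    rewrite mz ?(link_notin sL wN) // mulr0 addr0.
    have [->|wv] := eqVneq w v; first by rewrite -cE mulr1.
    by rewrite yw // !mulr0.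
  have wv : w != v by apply: contraNneq wN => ->.
  rewrite (negbTE wv) mulr0 add0r (bigD1 v) //= big1 ?addr0.
    by rewrite -cE -/c; ring.
  by move=> v' /andP[v'N v'v]; rewrite yw // !mul0r mulr0.
have lc0 : 0 < link_weight c by exact: link_weight_gt0.
have cgt0 : 0 < c by rewrite lt_def c0 andbT /c cE.
have l0 w : 0 <= c * link_weight c * (1 - c) * m v w.
  by rewrite !mulr_ge0 ?subr_ge0 // ltW.
have a0 w : 0 <= apex_weight c * (w == u)%:R.
  by rewrite mulr_ge0 ?ler0n ?apex_weight_ge0.
have t0 w : 0 <= top_weight c * c * (w == v)%:R.
  by rewrite !mulr_ge0 ?ler0n ?top_weight_ge0.
split=> [w|]; first by rewrite jE !addr_ge0.
split.
  under eq_bigr do rewrite jE.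
  rewrite !big_split /= -!mulr_sumr !sum_eq m1 !mulr1.
  by rewrite collapse_weights // c0.
have supp w : (w \in Defs.support (joined y m)) =
    [|| (c < 2^-1) && (w == u), (2^-1 < c) && (w == v) |
        (c < 1) && (w \in Defs.support (m v))].
  have -> : (w \in Defs.support (m v)) = (m v w != 0) by rewrite inE.
  rewrite [w \in _]inE jE !paddr_eq0 ?addr_ge0 // !negb_and -orbA.
  rewrite [apex_weight c * _ == 0]mulf_eq0 apex_weight_eq0.
  rewrite [_ * (w == v)%:R == 0]mulf_eq0 [_ * c == 0]mulf_eq0 top_weight_eq0.
  rewrite [_ * m v w == 0]mulf_eq0 [_ * (1 - c) == 0]mulf_eq0.
  rewrite [_ * link_weight c == 0]mulf_eq0 (gt_eqF cgt0) (gt_eqF lc0) /= orbF.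
  rewrite !negb_or !pnatr_eq0 !eqb0 !negbK subr_eq0 -!ltNge.
  by rewrite [c < 1]lt_def c1 andbT.
case: (ltgtP c 2^-1) (supp) => ch sE.
- have -> : Defs.support (joined y m) = u |: Defs.support (m v).
    apply/setP => w; rewrite sE finset.in_setU1 /=.
    by rewrite (_ : c < 1) //; lra.
  exact: K_cone_apex sL.
(* At [c = 1] the link component has weight 0 and the support shrinks to [v]. *)
- have [c_lt1|c_ge1] := ltP c 1.
    have -> : Defs.support (joined y m) = v |: Defs.support (m v).
      by apply/setP => w; rewrite sE finset.in_setU1 c_lt1.
    exact: K_cone_top.
  have -> : Defs.support (joined y m) = v |: finset.set0.
    apply/setP => w; rewrite sE finset.in_setU1 finset.in_set0 /=.
    by rewrite ltNge c_ge1.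
  exact: K_cone_top (link_set0 vN W0).
- have -> : Defs.support (joined y m) = Defs.support (m v).
    by apply/setP => w; rewrite sE /= (_ : c < 1) //; lra.
  exact: K_link sL.
Qed.

(** Continuity is required of the whole product with [m], since [m] alone may be discontinuous where
    its coefficient vanishes. *)
Lemma continuous_joined {Z : topologicalType} (y : Z -> T -> R)
    (m : Z -> T -> T -> R) p :
  (forall v, {for p, continuous (fun r => y r v)}) ->
  (forall v w, v \in N ->
    {for p, continuous (fun r => y r v * (1 - top_mass N (y r)) * m r v w)}) ->
  forall w, {for p, continuous (fun r => joined (y r) (m r) w)}.
Proof.
move=> yc mc w; have tc := continuous_top_mass (N := N) yc; rewrite /joined.
case: (w == u); first exact: continuous_apex_weight.
case: (w \in N).
  by apply: continuous_mul => //; exact: continuous_top_weight.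
apply: continuous_bigsum => v vN; apply: continuous_mul; last exact: mc.
exact: continuous_link_weight.
Qed.

(** Projection from the top [v] to its link: when [v] carries weight, it is the only top, and
    [1 - x v] is the weight outside [N]. At [x v = 1] the inverse of 0 is 0 and the result is the
    zero vector. *)
Definition link_part (v : T) (x : T -> R) (w : T) : R :=
  if w \in N then 0 else x w / (1 - x v).

Lemma link_part_realization x v : realization_set R K x -> v \in N ->
  0 < x v < 1 -> realization_set R (L v) (link_part v x).
Proof.
move=> xK vN /andP[xv0 xv1]; have xX := K_realization xK.
have xvn : x v != 0 by rewrite gt_eqF.
have x1 : 0 < 1 - x v by rewrite subr_gt0.
have [x0 [xsum sK]] := xK.
split=> [w|].
  by rewrite /link_part; case: ifP => // _; rewrite divr_ge0 // ltW.
split.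
  rewrite (bigID (fun w => w \in N)) /= big1 ?add0r => [|w wN]; last first.
    by rewrite /link_part wN.
  rewrite (eq_bigr (fun w => x w / (1 - x v))) => [|w wN]; last first.
    by rewrite /link_part (negbTE wN).
  rewrite -mulr_suml (@rest_mass _ _ _ N (point_of xX)) [bary _]/=.
  by rewrite (top_neq0 xX vN xvn) divff // gt_eqF.
have -> : Defs.support (link_part v x) = Defs.support x :\: N.
  apply/setP => w; rewrite finset.in_setD ![w \in Defs.support _]inE /link_part.
  case: (w \in N); first by rewrite eqxx.
  by rewrite mulf_eq0 invr_eq0 (gt_eqF x1) orbF.
by have [|//] := K_top sK vN; rewrite inE.
Qed.

Lemma joined_link_part x : realization_set R K x ->
  joined x (fun v => link_part v x) =1 collapse u N x.
Proof.
move=> xK w; have xX := K_realization xK; rewrite /joined /collapse.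
case: eqP => // _; have [//|wN] := boolP (w \in N).
rewrite {3}/top_mass !mulr_suml; apply: eq_bigr => v vN.
have [->|xv] := eqVneq (x v) 0; first by rewrite !(mul0r, mulr0).
rewrite /link_part (negbTE wN) (top_neq0 xX vN xv).
(* For [x v <> 1] the denominator cancels against [1 - c]; for [x v = 1] no weight is left outside
   [N] and both sides are 0. *)
have [xv1|xv1] := eqVneq (x v) 1; last first.
  by field; rewrite subr_eq0 eq_sym.
have : \sum_(k | k \notin N) x k = 0.
  by rewrite (@rest_mass _ _ _ N (point_of xX)) [bary _]/= (top_neq0 xX vN xv)
    xv1 subrr.
move/eqP; rewrite psumr_eq0 => [|k _]; last by case: xX.
move=> /allP/(_ w (mem_index_enum w)); rewrite wN /= => /eqP->.
by rewrite mul0r !mulr0.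
Qed.

(** * Contraction of the complex without the generating faces *)

Lemma K_contractible : contractible R (realization R K).
Proof.
pose Z : topologicalType := (realization R K * unit_interval R)%type.
(* The contractions are chosen for all [v] at once; a dummy pair fills in outside [N] or when [W v]
   is empty. *)
have contr v : exists hq : ((T -> R) -> unit_interval R -> T -> R) * (T -> R),
    v \in N -> W v != finset.set0 ->
    [/\ forall x t, realization_set R (L v) (hq.1 x t),
      forall x t, realization_set R (L v) x -> time t = 0 -> hq.1 x t = x,
      forall x t, time t = 1 -> hq.1 x t = hq.2 &
      forall (z : Z -> T -> R) (tau : Z -> unit_interval R) p,
        (forall v, {for p, continuous (fun r => z r v)}) ->
        (\forall r \near p, realization_set R (L v) (z r)) ->
        {for p, continuous tau} ->
        forall v, {for p, continuous (fun r => hq.1 (z r) (tau r) v)} ].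
  have [/andP[vN W0]|h] := boolP ((v \in N) && (W v != finset.set0)).
    have [_ /(contractible_bary Z)[hq hqP]] := GfP vN W0.
    by exists hq.
  by exists (fun x _ => x, fun=> 0) => vN W0; rewrite vN W0 in h.
have [hq hqP] := choice contr; pose h v := (hq v).1; pose q v := (hq v).2.
have z01 : 0 <= (0 : R) <= 1 by rewrite lexx ler01.
have o01 : 0 <= (1 : R) <= 1 by rewrite lexx ler01.
have hL v x t : v \in N -> W v != finset.set0 -> realization_set R (L v) (h v x t).
  by move=> vN W0; have [h1 _ _ _] := hqP v vN W0; exact: h1.
have qL v : v \in N -> W v != finset.set0 -> realization_set R (L v) (q v).
  move=> vN W0; have [h1 _ h3 _] := hqP v vN W0.
  (* Any starting vector reaches the centre at time 1, so the zero vector does. *)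
  by rewrite /q -(h3 (fun=> 0) (time_of o01)).
have xtop x v : v \in N -> bary (x : realization R K) v != 0 -> W v != finset.set0.
  move=> vN xv; have [] := @K_top _ v (bary_support x) vN; first by rewrite inE.
  by [].
have xuniq (x : realization R K) : {in N &, forall v w, bary x v != 0 ->
    bary x w != 0 -> v = w}.
  move=> v w vN wN xv xw.
  by apply: IndT_top_uniq (K_sub (bary_support x)) vN wN _ _; rewrite inE.
have c01 (x : realization R K) := @top_mass01 _ _ _ N x.
have tneq (x : realization R K) v : v \in N -> bary x v != 0 ->
    top_mass N (bary x) = bary x v.
  by move=> vN xv; have h1 := top_neq0 (K_realization (baryP x)) vN xv; exact: h1.
have bc1 v (p : Z) : {for p, continuous (fun r : Z => bary r.1 v)}.
  exact: (continuous_bary_comp continuous_fst).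
(* [psi] contracts the link component and keeps the suspension coordinate. *)
pose psi (p : Z) := joined (bary p.1) (fun v => h v (link_part v (bary p.1)) p.2).
have psiK p : realization_set R K (psi p).
  apply: joined_realization => [v _||v w vN wN|v vN xv].
  - exact: bary_ge0.
  - by have /andP[] := c01 p.1.
  - exact: xuniq.
  - by have W0 := xtop _ _ vN xv; split=> //; exact: hL.
(* [chi] fixes the link components at the centres and scales the suspension coordinates to 0. *)
pose chi (p : Z) := joined (fun v => (1 - time p.2) * bary p.1 v) q.
have r01 (t : unit_interval R) : 0 <= 1 - time t <= 1 by have := timeP t; lra.
have chiK p : realization_set R K (chi p).
  have /andP[r0 r1] := r01 p.2.
  have nz v : (1 - time p.2) * bary p.1 v != 0 -> bary p.1 v != 0.
    by apply: contra => /eqP->; rewrite mulr0.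
  apply: joined_realization => [v _||v w vN wN|v vN xv].
  - by rewrite mulr_ge0 ?bary_ge0.
  - have /andP[? ?] := c01 p.1; rewrite /top_mass -mulr_sumr.
    by rewrite mulr_ile1.
  - by move=> /nz xv /nz xw; exact: xuniq xv xw.
  - by have W0 := xtop _ _ vN (nz _ xv); split=> //; exact: qL.
have apexK : realization_set R K (joined (fun=> 0) q).
  apply: joined_realization => [v _||v w _ _|v _].
  - exact: lexx.
  - by rewrite /top_mass big1 // ler01.
  - by rewrite eqxx.
  - by rewrite eqxx.
exists (point_of apexK).
have term0 (x : realization R K) v : v \in N ->
    bary x v * (1 - top_mass N (bary x)) != 0 -> 0 < bary x v < 1.
  move=> vN; rewrite mulf_eq0 negb_or subr_eq0 => /andP[xv].
  by rewrite (tneq x v vN xv) lt_def xv bary_ge0 lt_def bary_le1 => ->.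
have psic : continuous (fun p => point_of (psiK p)).
  apply: continuous_realization => w; apply: continuous_for => p.
  apply: continuous_joined => // v k vN.
  have fc : {for p, continuous (fun r : Z =>
      bary r.1 v * (1 - top_mass N (bary r.1)))}.
    apply: continuous_mul => //; apply: continuous_sub; first exact: continuous_const.
    exact: continuous_top_mass.
  have [W0|W0] := eqVneq (W v) finset.set0.
    have xz (x : realization R K) : bary x v = 0.
      by apply/eqP; apply: contra_eqT W0 => /(xtop _ _ vN).
    apply: (continuous_near_eq (f := fun=> 0)); last exact: continuous_const.
    by near=> r; rewrite xz !mul0r.
  (* Where the coefficient vanishes, [link_part] may jump, but the coordinates of a point of a
     realization are bounded by 1. *)
  have [p0|pn0] := eqVneq (bary p.1 v * (1 - top_mass N (bary p.1))) 0.
    apply: continuous_mul_bounded => // r.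
    have [m0 [m1 _]] := hL v (link_part v (bary r.1)) r.2 vN W0.
    rewrite ger0_norm // -m1 (bigD1 k) //= lerDl.
    by apply: sumr_ge0.
  have /andP[xv0 xv1] := term0 _ _ vN pn0.
  apply: continuous_mul => //; have [_ _ _ hc] := hqP v vN W0.
  apply: (hc (fun r => link_part v (bary r.1)) (fun r => r.2)).
  - move=> z; rewrite /link_part; case: (z \in N); first exact: continuous_const.
    apply: continuous_mul => //; apply: continuous_inv.
      by rewrite subr_eq0 gt_eqF.
    by apply: continuous_sub => //; exact: continuous_const.
  (* The condition [0 < x v < 1] is open, so [link_part] stays in the realization nearby. *)
  - have n0 := cvgr_gt _ (bc1 v p) _ xv0.
    have n1 := cvgr_lt _ (bc1 v p) _ xv1.
    apply: filterS2 (n0 _) (n1 _) => r r0 r1.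
    by apply: link_part_realization (baryP _) vN _; rewrite r0 r1.
  - exact: continuous_snd.
have chic : continuous (fun p => point_of (chiK p)).
  have tc (p : Z) : {for p, continuous (fun r : Z => 1 - time r.2)}.
    apply: continuous_sub; first exact: continuous_const.
    exact: (continuous_compose continuous_snd continuous_time).
  have yc v (p : Z) : {for p, continuous (fun r : Z => (1 - time r.2) * bary r.1 v)}.
    by apply: continuous_mul.
  apply: continuous_realization => w; apply: continuous_for => p.
  apply: continuous_joined => // v k vN.
  apply: continuous_mul; last exact: continuous_const.
  apply: continuous_mul => //; apply: continuous_sub; first exact: continuous_const.
  by apply: continuous_top_mass => z; exact: yc.
pose psi0 x := point_of (psiK (x, time_of z01)).
pose psi1 x := point_of (psiK (x, time_of o01)).
have timeE r r01' : time (@time_of R r r01') = r by [].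
apply: (homotopic_trans (g := psi0)).
  apply: homotopic_sym; apply: (@collapse_homotopic _ _ _ u N).
  - exact: apex_notin_N.
  - move=> s /K_sub sX; apply: K_no_top (IndT_setD sX) _ => v vN.
    by rewrite finset.in_setD vN.
  - move=> s /K_sub sX; apply: K_no_top (IndT_apex sX) _ => v vN.
    rewrite finset.in_setU1 finset.in_setD vN orbF.
    by apply: contraTneq vN => ->; exact: apex_notin_N.
  - by move=> s v /K_sub; exact: IndT_apex_top.
  (* At time 0 the link components are not yet moved, so [psi0] is the collapse. *)
  - move=> x w; rewrite -(joined_link_part (baryP x)).
    rewrite /psi0 bary_point_of /psi /joined /=.
    case: (w == u) => //; case: (w \in N) => //; apply: eq_bigr => v vN.
    have [->|xn0] := eqVneq (bary x v * (1 - top_mass N (bary x))) 0.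
      by rewrite !mul0r.
    have xv := term0 _ _ vN xn0.
    have W0 : W v != finset.set0.
      by apply: (xtop x) => //; rewrite gt_eqF //; case/andP: xv.
    have [_ h0 _ _] := hqP v vN W0; rewrite /h h0 //.
    exact: link_part_realization (baryP x) vN xv.
apply: (homotopic_trans (g := psi1)).
  exists (fun p => point_of (psiK p)); split=> //; split=> x t tE.
    by congr (point_of (psiK (x, _))); apply: time_inj.
  by congr (point_of (psiK (x, _))); apply: time_inj.
(* [chi] starts where [psi] ends: every link component with nonzero coefficient has reached its
   centre. *)
exists (fun p => point_of (chiK p)); split=> //; split=> x t.
  rewrite -/(time t) => t0; apply: bary_inj => w.
  rewrite /psi1 !bary_point_of /chi /psi [time _]t0 [_.1]/=.
  have -> : (fun v => (1 - 0) * bary x v) = bary x.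
    by apply/funext => v; rewrite subr0 mul1r.
  rewrite /joined; case: (w == u) => //; case: (w \in N) => //.
  apply: eq_bigr => v vN.
  have [->|xv] := eqVneq (bary x v) 0; first by rewrite !mul0r.
  have [_ _ h1 _] := hqP v vN (xtop _ _ vN xv).
  by rewrite /h h1.
rewrite -/(time t) => t1; apply: bary_inj => w.
rewrite !bary_point_of /chi [time _]t1 [_.1]/=.
congr (joined _ _ _); apply/funext => v.
by rewrite subrr mul0r.
Unshelve. all: by end_near.
Qed.

(** A face containing [v |: s] is again a cone from [v] over a face of the link, and maximality of
    [s] there, or emptiness of [W v], leaves no room to grow. *)
Lemma Gens_maximal (t : {set T}) : t \in Gens -> maximal_face X t.
Proof.
have cone v (s t' : {set T}) : v \in N -> t' \in X -> v |: s \subset t' ->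
    t' = v |: (t' :\: N) /\ t' :\: N \in Ind e (W v).
  move=> vN tX /fintype.subsetP st.
  have vt : v \in t' by apply: st; rewrite finset.setU11.
  split; last exact: IndT_link tX vt.
  apply/setP => w; rewrite finset.in_setU1 finset.in_setD.
  have [->|wv] /= := eqVneq w v; first by rewrite vt.
  have [wN|//] /= := boolP (w \in N); apply/negbTE; apply: contra wv => wt.
  by apply/eqP; exact: IndT_top_uniq tX wN vN wt vt.
case/GensP=> [[v [vN W0 ->]]|[v [s [vN W0 sG ->]]]]; apply/andP; split.
- rewrite -[[set v]]finset.setU0; apply: (@IndT_cone_top v).
  by apply/in_Ind; split=> [|x y]; rewrite ?finset.sub0set ?inE.
- apply/forall_inP => t' tX; apply/implyP; rewrite -[[set v]]finset.setU0 => st.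
  have [tE] := cone _ _ _ vN tX st.
  move=> /in_Ind[+ _]; rewrite W0 finset.subset0 => /eqP tD.
  by rewrite tE tD.
- by apply: IndT_cone_top; exact: (Gf_maximal vN W0 sG).1.
- apply/forall_inP => t' tX; apply/implyP => st.
  have [tE tI] := cone _ _ _ vN tX st; have [sI smax] := Gf_maximal vN W0 sG.
  apply/eqP; rewrite {1}tE; congr (_ |: _); apply: smax => //.
  apply/fintype.subsetP => w ws; rewrite finset.in_setD.
  apply/andP; split; first by apply: contraL ws; exact: Ind_W_notin sI.
  by apply: (fintype.subsetP st); rewrite finset.in_setU1 ws orbT.
Qed.

End GeneratingFaces.
End SimplicialNeighbourhood.

Theorem theorem3p7 (R : realType) (T : finType) (e : rel T) (u : T) :
  simple_graph e ->
  (forall v w, v \in nbhd e u -> w \in nbhd e u -> v != w -> e v w) ->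
  homotopy_equivalent R
    (realization R (Ind e [set: T]))
    (realization R
       (wedge_cx (nbhd e u)
          (fun v => susp (Ind e (gminus (nbhd e u :|: nbhd e v))))
          (fun _ => inr true)))
  /\
  (forall Gf : T -> {set {set T}},
     (forall v, v \in nbhd e u -> gminus (nbhd e u :|: nbhd e v) != finset.set0 ->
        generating_faces R (Ind e (gminus (nbhd e u :|: nbhd e v))) (Gf v)) ->
     generating_faces R (Ind e [set: T])
       ([set [set v] | v in nbhd e u &
           gminus (nbhd e u :|: nbhd e v) == finset.set0] :|:
        [set t | [exists v in nbhd e u,
           (gminus (nbhd e u :|: nbhd e v) != finset.set0) &&
           [exists s in Gf v, t == v |: s]]])).
Proof.
move=> [e_sym e_irr] cliqueNu; split; first exact: Ind_wedge_equivalent.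
move=> Gf GfP; split; last exact: K_contractible.
by move=> t; exact: (Gens_maximal e_sym e_irr cliqueNu GfP).
Qed.
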